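(* Let $K$ be a field, let $\phi:\mathfrak g\to\mathfrak h$ be a homomorphism of Lie algebras over $K$, let $\mathfrak p=\operatorname{Im}(\phi)\subseteq\mathfrak h$, and let $\phi':\mathfrak g\to\mathfrak p$ be the epimorphism induced by $\phi$. Then $\operatorname{cd}(\phi)=\operatorname{cd}(\phi')$.
   Context: Lie algebras are over a field $K$ and may be infinite-dimensional. Modules over a Lie algebra $\mathfrak g$ are left $\mathfrak g$-modules, equivalently left modules over the universal enveloping algebra $U(\mathfrak g)$ (no finiteness assumption). $H^n(\mathfrak g,M)$ denotes Chevalley--Eilenberg cohomology (equivalently $\operatorname{Ext}^n_{U(\mathfrak g)}(K,M)$). For a Lie algebra homomorphism $\phi:\mathfrak g\to\mathfrak h$ and an $\mathfrak h$-module $M$, regarded as a $\mathfrak g$-module by restriction along $\phi$, there is an induced map $\phi^*:H^n(\mathfrak h,M)\to H^n(\mathfrak g,M)$ for each $n\ge 0$. The cohomological dimension of $\phi$ is $$\operatorname{cd}(\phi)=\sup\{n\ge 0:\ \text{there is an }\mathfrak h\text{-module }M\text{ with }\phi^*:H^n(\mathfrak h,M)\to H^n(\mathfrak g,M)\text{ nonzero}\},$$ a value in $\{0,1,2,\dots\}\cup\{\infty\}$. *)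

(* Defs.v *)
From HB Require Import structures.
From mathcomp Require Import all_boot all_order all_algebra.
From mathcomp Require Import ring_quotient.
From mathcomp Require Import mathcomp_extra boolp classical_sets functions.

Set Implicit Arguments.
Unset Strict Implicit.
Unset Printing Implicit Defensive.

Import GRing.Theory.
Local Open Scope ring_scope.
Local Open Scope quotient_scope.

HB.mixin Record Lmodule_isLieAlgebra (K : fieldType) L
    of GRing.Lmodule K L := {
  lie : L -> L -> L;
  lie_linearl : forall y, linear (lie^~ y);
  lie_linearr : forall x, linear (lie x);
  liexx : forall x, lie x x = 0;
  lie_jacobi : forall x y z,
    lie x (lie y z) + lie y (lie z x) + lie z (lie x y) = 0
}.

#[short(type="lieAlgType")]
HB.structure Definition LieAlgebra (K : fieldType) :=
  {L of GRing.Lmodule K L & Lmodule_isLieAlgebra K L}.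

HB.mixin Record Lmodule_isLieModule (K : fieldType) (g : lieAlgType K) M
    of GRing.Lmodule K M := {
  lact : g -> M -> M;
  lact_linearl : forall m, linear (lact^~ m);
  lact_linearr : forall x, linear (lact x);
  lact_lie : forall x y m,
    lact (lie x y) m = lact x (lact y m) - lact y (lact x m)
}.

#[short(type="lieModType")]
HB.structure Definition LieModule (K : fieldType) (g : lieAlgType K) :=
  {M of GRing.Lmodule K M & Lmodule_isLieModule K g M}.

HB.mixin Record isLieMorphism (K : fieldType) (g h : lieAlgType K)
    (f : g -> h) := {
  lie_morph : {morph f : x y / lie x y}
}.

HB.structure Definition LieMorphism (K : fieldType) (g h : lieAlgType K) :=
  {f of @GRing.Linear K g h *:%R f & isLieMorphism K g h f}.

Notation "{ 'lieMorphism' g '->' h }" := (LieMorphism.type g h)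
  (at level 0, g at level 98, h at level 99,
   format "{ 'lieMorphism'  g  ->  h }") : type_scope.

Section LieImage.
Variables (K : fieldType) (g h : lieAlgType K) (phi : {lieMorphism g -> h}).

Definition lie_im : {pred h} := [pred y | `[< exists x, phi x = y >]].

Lemma lie_imP y : reflect (exists x, phi x = y) (y \in lie_im).
Proof. exact: asboolP. Qed.

Lemma lie_im_submod_closed : submod_closed lie_im.
Proof.
split; first by apply/lie_imP; exists 0; rewrite linear0.
move=> a _ _ /lie_imP[x <-] /lie_imP[y <-].
by apply/lie_imP; exists (a *: x + y); rewrite linearP.
Qed.

HB.instance Definition _ :=
  GRing.isSubmodClosed.Build K h lie_im lie_im_submod_closed.

Record lie_image := LieImage { lie_incl :> h; _ : lie_incl \in lie_im }.

HB.instance Definition _ := [isSub for lie_incl].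
HB.instance Definition _ := [Choice of lie_image by <:].
HB.instance Definition _ := [SubChoice_isSubLmodule of lie_image by <:].

Lemma lie_im_lie (x y : lie_image) : lie (val x) (val y) \in lie_im.
Proof.
case: x y => [_ /= /lie_imP[x <-]] [_ /= /lie_imP[y <-]].
by apply/lie_imP; exists (lie x y); rewrite lie_morph.
Qed.

Definition lie_image_lie (x y : lie_image) : lie_image :=
  LieImage (lie_im_lie x y).

Fact lie_image_linearl y : linear (lie_image_lie^~ y).
Proof. by move=> a u v; apply: val_inj; rewrite /= lie_linearl. Qed.

Fact lie_image_linearr x : linear (lie_image_lie x).
Proof. by move=> a u v; apply: val_inj; rewrite /= lie_linearr. Qed.

Fact lie_image_liexx x : lie_image_lie x x = 0.
Proof. by apply: val_inj; rewrite /= liexx. Qed.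

Fact lie_image_jacobi x y z :
  lie_image_lie x (lie_image_lie y z) + lie_image_lie y (lie_image_lie z x) +
    lie_image_lie z (lie_image_lie x y) = 0.
Proof. by apply: val_inj; rewrite /= lie_jacobi. Qed.

HB.instance Definition _ := Lmodule_isLieAlgebra.Build K lie_image
  lie_image_linearl lie_image_linearr lie_image_liexx lie_image_jacobi.

Lemma lie_im_corestr x : phi x \in lie_im.
Proof. by apply/lie_imP; exists x. Qed.

(* [phi] with its codomain restricted to its image *)
Definition lie_corestr (x : g) : lie_image := LieImage (lie_im_corestr x).

Fact lie_corestr_linear : linear lie_corestr.
Proof. by move=> a u v; apply: val_inj; rewrite /= linearP. Qed.

Fact lie_corestr_lie : {morph lie_corestr : x y / lie x y}.
Proof. by move=> u v; apply: val_inj; rewrite /= lie_morph. Qed.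

HB.instance Definition _ :=
  GRing.isLinear.Build K g lie_image *:%R lie_corestr lie_corestr_linear.
HB.instance Definition _ :=
  isLieMorphism.Build K g lie_image lie_corestr lie_corestr_lie.

Lemma lie_corestr_surj (y : lie_image) : exists x, lie_corestr x = y.
Proof.
by case: y => y yim; case/lie_imP: (yim) => x xy; exists x; apply: val_inj.
Qed.

End LieImage.

(* [M] with the action of [g] through [phi] *)
Definition lie_res (K : fieldType) (g h : lieAlgType K)
  (phi : {lieMorphism g -> h}) (M : lieModType h) : Type := M.

Section Restriction.
Variables (K : fieldType) (g h : lieAlgType K) (phi : {lieMorphism g -> h}).
Variable M : lieModType h.

HB.instance Definition _ := GRing.Lmodule.on (lie_res phi M).

Definition res_act (x : g) (m : lie_res phi M) : lie_res phi M :=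
  lact (phi x) (m : M).

Fact res_act_linearl m : linear (res_act^~ m).
Proof. by move=> a x y; rewrite /res_act linearP lact_linearl. Qed.

Fact res_act_linearr x : linear (res_act x).
Proof. by move=> a m n; rewrite /res_act lact_linearr. Qed.

Fact res_act_lie x y m :
  res_act (lie x y) m = res_act x (res_act y m) - res_act y (res_act x m).
Proof. by rewrite /res_act lie_morph lact_lie. Qed.

HB.instance Definition _ := Lmodule_isLieModule.Build K g (lie_res phi M)
  res_act_linearl res_act_linearr res_act_lie.

End Restriction.

Section Cochains.
Variables (K : fieldType) (g : lieAlgType K) (M : lieModType g) (n : nat).
Implicit Types (x : 'I_n -> g) (c : ('I_n -> g) -> M).

Definition arg_upd x (i : 'I_n) (u : g) : 'I_n -> g :=
  fun j => if j == i then u else x j.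

Definition multilinear c :=
  forall x i a u v,
    c (arg_upd x i (a *: u + v)) = a *: c (arg_upd x i u) + c (arg_upd x i v).

Definition alternating c := forall x i j, i != j -> x i = x j -> c x = 0.

Definition cochain_pred : {pred ('I_n -> g) -> M} :=
  [pred c | `[< multilinear c /\ alternating c >]].

Lemma cochain_predP c :
  reflect (multilinear c /\ alternating c) (c \in cochain_pred).
Proof. exact: asboolP. Qed.

Lemma cochain_submod_closed : submod_closed cochain_pred.
Proof.
split.
  by apply/cochain_predP; split=> [x i a u v|//]; rewrite scaler0 addr0.
move=> k c d /cochain_predP[cl ca] /cochain_predP[dl da].
apply/cochain_predP; split=> [x i a u v|x i j ij xij].
  change (k *: c (arg_upd x i (a *: u + v)) + d (arg_upd x i (a *: u + v)) =
    a *: (k *: c (arg_upd x i u) + d (arg_upd x i u)) +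
    (k *: c (arg_upd x i v) + d (arg_upd x i v))).
  by rewrite cl dl !scalerDr !scalerA [k * a]mulrC addrACA.
change (k *: c x + d x = 0).
by rewrite (ca _ _ _ ij) // (da _ _ _ ij) // scaler0 addr0.
Qed.

HB.instance Definition _ := GRing.isSubmodClosed.Build K
  (('I_n -> g) -> M) cochain_pred cochain_submod_closed.

(* the space Hom_K(Lambda^n g, M) of alternating n-linear maps *)
Record cochain :=
  Cochain { cochain_fun :> ('I_n -> g) -> M; _ : cochain_fun \in cochain_pred }.

HB.instance Definition _ := [isSub for cochain_fun].
HB.instance Definition _ := [Choice of cochain by <:].
HB.instance Definition _ := [SubChoice_isSubLmodule of cochain by <:].

End Cochains.

Arguments cochain_pred {K g} M n.
Arguments cochain {K g} M n.

Section Differential.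
Variables (K : fieldType) (g : lieAlgType K) (M : lieModType g) (n : nat).
Implicit Types (x : 'I_n.+1 -> g) (c : cochain M n).

(* For i < j, the n-tuple ([x_i, x_j], x_0, .., x_n) with x_i and x_j omitted
   from the tail: k |-> bump j (bump i k) enumerates the indices other than i
   and j in increasing order. *)
Definition lie_args x (i j : 'I_n.+1) : 'I_n -> g :=
  fun k => if (k : nat) is k'.+1 then x (inord (bump j (bump i k')))
           else lie (x i) (x j).

Definition ce_diff c : ('I_n.+1 -> g) -> M := fun x =>
  \sum_(i < n.+1) (-1) ^+ i *: lact (x i) (c (x \o lift i)) +
  \sum_(i < n.+1) \sum_(j < n.+1 | (i < j)%N)
    (-1) ^+ (i + j) *: c (lie_args x i j).

Lemma ce_diff_linear : linear ce_diff.
Proof.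
move=> a c d; apply/funext => x; rewrite /ce_diff.
rewrite -[RHS]/(a *: (_ + _) + (_ + _)) scalerDr addrACA.
congr (_ + _); rewrite scaler_sumr -big_split /=; last first.
  apply: eq_bigr => i _; rewrite scaler_sumr -big_split /=.
  apply: eq_bigr => j _.
  rewrite -[X in X = _]/(_ *: (a *: c _ + d _)).
  by rewrite scalerDr !scalerA [a * _]mulrC.
apply: eq_bigr => i _.
rewrite -[X in X = _]/(_ *: lact _ (a *: c _ + d _)).
by rewrite lact_linearr scalerDr !scalerA [a * _]mulrC.
Qed.

HB.instance Definition _ := GRing.isLinear.Build K (cochain M n)
  (('I_n.+1 -> g) -> M) *:%R ce_diff ce_diff_linear.

End Differential.

Section Cocycles.
Variables (K : fieldType) (g : lieAlgType K) (M : lieModType g) (n : nat).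

Definition cocycle_pred : {pred cochain M n} := [pred c | ce_diff c == 0].

Lemma cocycle_submod_closed : submod_closed cocycle_pred.
Proof.
split=> [|a c d]; rewrite !inE ?linear0 // => c0 d0.
by rewrite ce_diff_linear c0 d0 scaler0 addr0.
Qed.

HB.instance Definition _ := GRing.isSubmodClosed.Build K
  (cochain M n) cocycle_pred cocycle_submod_closed.

Record cocycle :=
  Cocycle { cocycle_cochain :> cochain M n;
            _ : cocycle_cochain \in cocycle_pred }.

HB.instance Definition _ := [isSub for cocycle_cochain].
HB.instance Definition _ := [Choice of cocycle by <:].
HB.instance Definition _ := [SubChoice_isSubLmodule of cocycle by <:].

End Cocycles.

Arguments cocycle_pred {K g} M n.
Arguments cocycle {K g} M n.

Definition is_coboundary (K : fieldType) (g : lieAlgType K) (M : lieModType g)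
    (n : nat) : cochain M n -> Prop :=
  match n with
  | 0 => fun c => c = 0
  | m.+1 => fun c => exists b : cochain M m, ce_diff b = c
  end.

Section CohomologyGroup.
Variables (K : fieldType) (g : lieAlgType K) (M : lieModType g) (n : nat).

(* ce_diff takes values in all functions, not in [cochain M n.+1], and the
   coboundaries are cut out inside the cocycles; so neither d^2 = 0 nor the
   alternating multilinearity of d c is needed to form the quotient. *)
Definition coboundary_pred : {pred cocycle M n} :=
  [pred z : cocycle M n | `[< is_coboundary z >]].

Lemma coboundary_zmod_closed : zmod_closed coboundary_pred.
Proof.
rewrite /coboundary_pred; split; first by apply/asboolP; case: n => [//|m] /=;
  exists 0; rewrite linear0.
move=> [c cP] [d dP] /asboolP/= cB /asboolP/= dB; apply/asboolP => /=.
case: n c d {cP dP} cB dB => [|m] c d /=; first by move=> -> ->; rewrite subr0.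
by move=> [b bc] [e ed]; exists (b - e); rewrite linearB /= bc ed.
Qed.

HB.instance Definition _ := GRing.isZmodClosed.Build
  (cocycle M n) coboundary_pred coboundary_zmod_closed.

Definition cohomology : Type := Quotient.quot coboundary_pred.

HB.instance Definition _ := ZmodQuotient.on cohomology.
HB.instance Definition _ := Choice.on cohomology.

Definition coh_class (z : cocycle M n) : cohomology := \pi z.

End CohomologyGroup.

Arguments coboundary_pred {K g} M n.
Arguments cohomology {K g} M n.

Section InducedMap.
Variables (K : fieldType) (g h : lieAlgType K) (phi : {lieMorphism g -> h}).
Variable M : lieModType h.

Lemma pullback_cochain n (c : cochain M n) :
  (fun x : 'I_n -> g => c (phi \o x) : lie_res phi M) \in
    cochain_pred (lie_res phi M) n.
Proof.
case: c => c /= /cochain_predP[cl ca]; apply/cochain_predP.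
have upd (x : 'I_n -> g) i u :
    phi \o arg_upd x i u = arg_upd (phi \o x) i (phi u).
  by apply/funext => j; rewrite /= /arg_upd; case: eqP.
split=> [x i a u v|x i j ij xij]; first by rewrite !upd linearP cl.
by rewrite (ca _ _ _ ij) //= xij.
Qed.

Definition pullback n (c : cochain M n) : cochain (lie_res phi M) n :=
  Cochain (pullback_cochain c).

Fact pullback_linear n : linear (@pullback n).
Proof. by move=> a c d; apply: val_inj. Qed.

HB.instance Definition _ n := GRing.isLinear.Build K (cochain M n)
  (cochain (lie_res phi M) n) *:%R (@pullback n) (@pullback_linear n).

Lemma ce_diff_pullback n (c : cochain M n) x :
  ce_diff (pullback c) x = ce_diff c (phi \o x).
Proof.
rewrite /ce_diff; congr (_ + _); apply: eq_bigr => i _; apply: eq_bigr => j _.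
congr (_ *: c _); apply/funext => k; rewrite /= /lie_args.
by case: (k : nat) => [|k'] //; rewrite lie_morph.
Qed.

Lemma pullback_cocycle n (z : cocycle M n) :
  pullback z \in cocycle_pred (lie_res phi M) n.
Proof.
case: z => z /=; rewrite !inE => dz0; apply/funext => x.
by rewrite ce_diff_pullback dz0.
Qed.

Definition pullback_cocyc n (z : cocycle M n) : cocycle (lie_res phi M) n :=
  Cocycle (pullback_cocycle z).

Fact pullback_cocyc_linear n : linear (@pullback_cocyc n).
Proof. by move=> a c d; apply: val_inj; apply: val_inj. Qed.

HB.instance Definition _ n := GRing.isLinear.Build K (cocycle M n)
  (cocycle (lie_res phi M) n) *:%R (@pullback_cocyc n)
  (@pullback_cocyc_linear n).

Lemma pullback_coboundary n (z : cocycle M n) :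
  z \in coboundary_pred M n ->
  pullback_cocyc z \in coboundary_pred (lie_res phi M) n.
Proof.
move=> /asboolP zB; apply/asboolP; case: z zB => [z zP] /= {zP}.
case: n z => [|m] z /=; first by move=> ->; rewrite linear0.
move=> [b bz]; exists (pullback b); apply/funext => x.
by rewrite ce_diff_pullback bz.
Qed.

Definition coh_map n (a : cohomology M n) : cohomology (lie_res phi M) n :=
  coh_class (pullback_cocyc (repr a)).

Lemma coh_map_class n (z : cocycle M n) :
  coh_map (coh_class z) = coh_class (pullback_cocyc z).
Proof.
rewrite /coh_map; apply/eqP; rewrite -Quotient.idealrBE -linearB.
by apply: pullback_coboundary; rewrite Quotient.idealrBE reprK.
Qed.

Fact coh_map_is_zmod_morphism n : zmod_morphism (@coh_map n).
Proof.
move=> a b; rewrite -[a]reprK -[b]reprK -raddfB !coh_map_class linearB.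
exact: raddfB.
Qed.

HB.instance Definition _ n := GRing.isZmodMorphism.Build (cohomology M n)
  (cohomology (lie_res phi M) n) (@coh_map n) (@coh_map_is_zmod_morphism n).

End InducedMap.

(* The supremum of [A] in nat + {infinity}, with [None] as infinity: the least
   upper bound of [A] if there is one (hence 0 if [A] is empty). *)
Definition nat_sup (A : nat -> Prop) : option nat :=
  match pselect (exists m, `[< forall n, A n -> (n <= m)%N >]) with
  | left bA => Some (ex_minn bA)
  | right _ => None
  end.

Lemma nat_sup_SomeP (A : nat -> Prop) m :
  nat_sup A = Some m <->
  (forall n, A n -> (n <= m)%N) /\
  (forall k, (forall n, A n -> (n <= k)%N) -> (m <= k)%N).
Proof.
rewrite /nat_sup; case: pselect => [bA|nbA]; last first.
  by split=> // -[ub _]; case: nbA; exists m; apply/asboolP.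
case: ex_minnP => l /asboolP lub lmin; split=> [[<-]|[mub mmin]].
  by split=> // k kub; apply: lmin; apply/asboolP.
congr Some; apply/eqP; rewrite eqn_leq mmin // andbT.
by apply: lmin; apply/asboolP.
Qed.

Lemma nat_sup_NoneP (A : nat -> Prop) :
  nat_sup A = None <-> forall m, exists2 n, A n & (m < n)%N.
Proof.
rewrite /nat_sup; case: pselect => [bA|nbA]; split=> //.
  move=> unb; exfalso; case: bA => l /asboolP lub.
  by have [n An] := unb l; rewrite ltnNge lub.
move=> _ m; apply: contrapT => nA; apply: nbA; exists m; apply/asboolP => n An.
by rewrite leqNgt; apply/negP => mn; apply: nA; exists n.
Qed.

Definition lie_cd (K : fieldType) (g h : lieAlgType K)
    (phi : {lieMorphism g -> h}) : option nat :=
  nat_sup (fun n => exists M : lieModType h,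
    exists a : cohomology M n, coh_map phi a != 0).

(* Main.v *)
(* The inequality cd(phi) <= cd(phi') is restriction along p -> h. For the
   converse, a cocycle z of p with values in a p-module N must be extended to
   a cocycle b of h with values in the coinduced module
   M = Hom_U(p)(U(h), N), in the sense that b restricted to p and evaluated at
   1 is z: evaluation at 1 then maps the class phi^*[b] to phi'^*[z].

   This extension is surjectivity in Shapiro's lemma. Fix a totally ordered
   basis of h in which a basis of p comes first. By the Poincare-Birkhoff-Witt
   theorem, an element of M is an arbitrary N-valued function of the sorted
   words in the basis letters outside p. The value of b(I) at a word w is
   defined by induction on the length of w. If the largest letter m among w and
   I occurs in I, the value is zero; otherwise w = w' m, and the value is the
   one forced by (db)(m, I)(w') = 0. That db then vanishes altogether follows,
   by induction on the length of w, from d(db) = 0. This is the contraction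
   of the Koszul complex that removes the largest letter, lifted from the
   associated graded complex. *)

From HB Require Import structures.
From mathcomp Require Import all_boot all_order all_algebra.
From mathcomp Require Import boolp classical_sets functions wochoice zify.
Require Import Defs.

Set Implicit Arguments.
Unset Strict Implicit.
Unset Printing Implicit Defensive.
Import GRing.Theory.
Local Open Scope ring_scope.

(** * Linear identities in commutative groups *)

Inductive zexp := ZZero | ZAtom of nat | ZAdd of zexp & zexp | ZOpp of zexp.

Fixpoint zcoef (e : zexp) (i : nat) : int :=
  match e with
  | ZZero => 0
  | ZAtom j => (i == j)%:Z
  | ZAdd e1 e2 => zcoef e1 i + zcoef e2 i
  | ZOpp e1 => - zcoef e1 i
  end.

Fixpoint zeval (V : zmodType) (env : seq V) (e : zexp) : V :=
  match e with
  | ZZero => 0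
  | ZAtom j => env`_j
  | ZAdd e1 e2 => zeval env e1 + zeval env e2
  | ZOpp e1 => - zeval env e1
  end.

Lemma zevalE (V : zmodType) (env : seq V) e :
  zeval env e = \sum_(i < size env) env`_i *~ zcoef e i.
Proof.
elim: e => [|j|e1 IH1 e2 IH2|e1 IH1] /=.
- by rewrite big1.
- have [jlt|jge] := ltnP j (size env); last first.
    rewrite nth_default // big1 // => i _; case: eqP => // ij.
    by move: (ltn_ord i); rewrite ij ltnNge jge.
  rewrite (bigD1 (Ordinal jlt)) //= eqxx big1 ?addr0 // => i.
  by rewrite -val_eqE /=; case: eqP.
- by rewrite IH1 IH2 -big_split; apply: eq_bigr => i _; rewrite mulrzDr.
- by rewrite IH1 -sumrN; apply: eq_bigr => i _; rewrite mulrNz.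
Qed.

(** Each side is a sum of atoms weighted by integers, so comparing finitely many coefficients by
    computation suffices. This is the check that [zmodule] runs. *)
Lemma zeval_eq (V : zmodType) (env : seq V) e1 e2 :
  all (fun i => zcoef e1 i == zcoef e2 i) (iota 0 (size env)) ->
  zeval env e1 = zeval env e2.
Proof.
move=> /allP e12; rewrite !zevalE; apply: eq_bigr => i _.
by rewrite (eqP (e12 i _)) // mem_iota /=.
Qed.

(** The [match goal] forces [unify] to run while a term is being built, so atoms are identified up
    to unification. *)
Ltac zm_same x y := match goal with _ => unify x y end.
Ltac zm_add x env :=
  match env with
  | nil => constr:(cons x nil)
  | cons ?y _ => let _ := zm_same x y in env
  | cons ?y ?env' => let e := zm_add x env' in constr:(cons y e)
  end.
Ltac zm_idx x env :=
  match env with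
  | cons ?y _ => let _ := zm_same x y in constr:(O)
  | cons _ ?env' => let n := zm_idx x env' in constr:(S n)
  end.
Ltac zm_collect t env :=
  lazymatch t with
  | (?a + ?b)%R => let e := zm_collect a env in zm_collect b e
  | (- ?a)%R => zm_collect a env
  | 0%R => env
  | _ => zm_add t env
  end.
Ltac zm_reify t env :=
  lazymatch t with
  | (?a + ?b)%R =>
    let x := zm_reify a env in let y := zm_reify b env in constr:(ZAdd x y)
  | (- ?a)%R => let x := zm_reify a env in constr:(ZOpp x)
  | 0%R => constr:(ZZero)
  | _ => let n := zm_idx t env in constr:(ZAtom n)
  end.
Ltac zmodule :=
  lazymatch goal with
  | |- @eq ?T ?a ?b =>
    let env0 := zm_collect a (@nil T) in
    let env := zm_collect b env0 in
    let x := zm_reify a env in let y := zm_reify b env in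
    refine (@zeval_eq _ env x y _); vm_compute; reflexivity
  end.

(** * Ordered bases adapted to a subspace *)

Section AdaptedBasis.
Variables (K : fieldType) (V : lmodType K) (S : {pred V}).

Definition span (A : V -> Prop) (x : V) :=
  exists2 l : seq (K * V),
    (forall t, t \in l -> A t.2) & x = \sum_(t <- l) t.1 *: t.2.

Lemma span0 A : span A 0.
Proof. by exists [::]; rewrite ?big_nil. Qed.

Lemma span_mem (A : V -> Prop) x : A x -> span A x.
Proof.
move=> Ax; exists [:: (1, x)]; last by rewrite big_seq1 scale1r.
by move=> t; rewrite inE => /eqP ->.
Qed.

Lemma spanD A a x y : span A x -> span A y -> span A (a *: x + y).
Proof.
move=> [l lA ->] [m mA ->]; exists ([seq (a * t.1, t.2) | t <- l] ++ m).
  by move=> t; rewrite mem_cat => /orP[/mapP[s sl ->]|tm]; [exact: (lA s)|exact: mA].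
rewrite big_cat big_map /= scaler_sumr; congr (_ + _).
by apply: eq_bigr => t _; rewrite scalerA.
Qed.

Lemma span_sum A (l : seq (K * V)) :
  (forall t, t \in l -> span A t.2) -> span A (\sum_(t <- l) t.1 *: t.2).
Proof.
elim: l => [|t l IHl] lA; first by rewrite big_nil; apply: span0.
rewrite big_cons; apply: spanD; first by apply: lA; rewrite mem_head.
by apply: IHl => s sl; apply: lA; rewrite inE sl orbT.
Qed.

Lemma span_trans (A A' : V -> Prop) x :
  (forall y, A y -> span A' y) -> span A x -> span A' x.
Proof. by move=> AA' [l lA ->]; apply: span_sum => t tl; apply/AA'/lA. Qed.

(* A well-order in which [S] is an initial segment. *)
Definition adle : rel V := fun x y =>
  if (x \in S) == (y \in S) then sval (well_ordering_principle V) x y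
  else x \in S.

Definition adlt : rel V := fun x y => adle x y && (x != y).

(** Members of [S] come first: the least element is sought among them when [A] meets [S], and in all
    of [A] otherwise. *)
Lemma adle_min (A : V -> Prop) x : A x ->
  exists2 z, A z & forall y, A y -> adle z y.
Proof.
rewrite /adle; case: well_ordering_principle => R wo /= Ax.
have minP (P : V -> Prop) u : P u -> exists2 z, P z & forall y, P y -> R z y.
  move=> Pu; have [|z [[Pz zmin] _]] := wo (fun y => `[< P y >]).
    by exists u; apply/asboolP.
  by exists z => [|y Py]; [exact/asboolP|apply: zmin; apply/asboolP].
have [[u uS Au]|noS] := pselect (exists2 u, u \in S & A u).
  have [z [zS Az] zmin] := minP (fun y => y \in S /\ A y) u (conj uS Au).
  exists z => // y Ay; rewrite zS; case: ifPn => //=.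
  by move/eqP=> yS; apply: zmin; rewrite -yS.
have [z Az zmin] := minP _ _ Ax; exists z => // y Ay.
have nS t : A t -> (t \in S) = false.
  by move=> At; apply/negP => tS; apply: noS; exists t.
by rewrite !nS //=; apply: zmin.
Qed.

Lemma adle_xx x : adle x x.
Proof. by have [z <-] := @adle_min (eq x) x erefl; apply. Qed.

Lemma adle_total : total adle.
Proof.
move=> x y; have [|z] := @adle_min (fun z => z = x \/ z = y) x; first by left.
by case=> -> zmin; apply/orP; [left|right]; apply: zmin; [right|left].
Qed.

Lemma adle_anti : antisymmetric adle.
Proof.
rewrite /adle => x y; case: well_ordering_principle => R wo /= xy.
have [|z [_ zu]] := wo (pred2 x y); first by exists x; rewrite !inE eqxx.
have [Rxy Ryx] : R x y /\ R y x.
  by move: xy; rewrite [(y \in S) == _]eq_sym; case: eqP => [_ /andP[]|] //;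
    case: (x \in S); case: (y \in S).
have Rtt t u : R t u -> R u t -> R t t.
  move=> tu ut; have [|w [[+ wmin] _]] := wo (pred1 t).
    by exists t; rewrite inE.
  by rewrite inE => /eqP wt; rewrite wt in wmin; apply: wmin; rewrite inE.
rewrite -(zu x) ?(zu y) //; split; rewrite ?inE ?eqxx ?orbT //.
  by move=> t; rewrite !inE => /orP[] /eqP-> //; apply: Rtt Rxy.
by move=> t; rewrite !inE => /orP[] /eqP-> //; apply: Rtt Ryx.
Qed.

Lemma adle_trans : transitive adle.
Proof.
move=> y x z xy yz.
have [|t] := @adle_min (fun t => [\/ t = x, t = y | t = z]) x; first exact: Or31.
case=> -> tmin; first by apply: tmin; apply: Or33.
  suff -> : x = y by [].
  by apply: adle_anti; rewrite xy tmin //; apply: Or31.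
suff <- : y = z by [].
by apply: adle_anti; rewrite yz tmin //; apply: Or32.
Qed.

Lemma adle_sub x y : adle x y -> y \in S -> x \in S.
Proof. by rewrite /adle => + yS; rewrite yS; case: (x \in S). Qed.

Lemma adltNle x y : adlt x y = ~~ adle y x.
Proof.
rewrite /adlt; have [/= yx|nyx] := boolP (adle y x).
  by apply/negP => /andP[xy /eqP]; apply; apply: adle_anti; rewrite xy.
have := adle_total y x; rewrite (negPf nyx) /= => -> /=.
by apply: contraNneq nyx => ->; apply: adle_xx.
Qed.

Lemma adlt_ind (P : V -> Prop) :
  (forall x, (forall y, adlt y x -> P y) -> P x) -> forall x, P x.
Proof.
move=> Pind x; apply: contrapT => nPx.
have [z nPz zmin] := @adle_min (fun x => ~ P x) x nPx.
apply/nPz/Pind => y; rewrite adltNle => yz; apply: contrapT => nPy.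
by move: yz; rewrite zmin.
Qed.

(* A well-ordered family spans the same space as the family of those members
   that do not depend on smaller ones. *)
Definition basic (b : V) : bool := ~~ `[< span (adlt^~ b) b >].

(** Well-founded induction: a vector that is not basic is a combination of smaller ones. *)
Lemma basic_span x : span (fun b => basic b /\ adle b x) x.
Proof.
elim/adlt_ind: x => x IH; have [bx|] := boolP (basic x).
  by apply: span_mem; rewrite adle_xx.
rewrite negbK => /asboolP; apply: span_trans => y yx.
apply: span_trans (IH y yx) => b [bb byy]; apply: span_mem; split=> //.
by apply: adle_trans byy _; case/andP: yx.
Qed.

Lemma max_mem (T : eqType) (f : T -> V) x (s : seq T) :
  exists2 m, m \in x :: s & forall y, y \in x :: s -> adle (f y) (f m).
Proof.
elim: s x => [|z s IHs] x.
  by exists x; rewrite ?mem_head // => y; rewrite inE => /eqP->; apply: adle_xx.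
have [m ms mmax] := IHs z; case/orP: (adle_total (f x) (f m)) => xm.
  exists m; first by rewrite inE ms orbT.
  by move=> y; rewrite inE => /orP[/eqP->//|]; apply: mmax.
exists x => [|y]; first exact: mem_head.
rewrite inE => /orP[/eqP->|ys]; first exact: adle_xx.
by apply: adle_trans xm; apply: mmax.
Qed.

Lemma basic_free (W : lmodType K) (F : V -> W) (l : seq (K * V)) :
  (forall t, t \in l -> basic t.2) -> \sum_(t <- l) t.1 *: t.2 = 0 ->
  \sum_(t <- l) t.1 *: F t.2 = 0.
Proof.
have [n] := ubnP (size l); elim: n l => // n IHn [|t0 l0]; first by rewrite !big_nil.
set l := t0 :: l0 => szl lB l0E.
have [m ml mmax] := max_mem (fun t : K * V => t.2) t0 l0; rewrite -/l in ml mmax.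
pose c := \sum_(t <- l | t.2 == m.2) t.1.
pose l' := [seq t <- l | t.2 != m.2].
have split_sum (W' : lmodType K) (G : V -> W') : \sum_(t <- l) t.1 *: G t.2 =
    c *: G m.2 + \sum_(t <- l') t.1 *: G t.2.
  rewrite (bigID (fun t => t.2 == m.2)) /= big_filter; congr (_ + _).
  by rewrite scaler_suml; apply: eq_bigr => t /eqP->.
have c0 : c = 0.
  apply: contraTeq (lB _ ml) => cn0; rewrite negbK; apply/asboolP.
  have /esym/eqP := split_sum _ id; rewrite l0E addr_eq0 => /eqP.
  move=> /(congr1 ( *:%R c^-1)); rewrite scalerK // => mE.
  rewrite [X in span _ X]mE scalerN -scaleNr -[X in span _ X]addr0.
  apply: spanD; last exact: span0.
  apply: span_sum => t; rewrite mem_filter => /andP[tm tl].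
  by apply: span_mem; rewrite /adlt mmax.
rewrite split_sum c0 scale0r add0r; apply: IHn.
- rewrite ltnS in szl; apply: leq_trans szl;
  rewrite size_filter -(count_predC (fun t => t.2 == m.2) l).
  rewrite -[X in (X < _)%N]add0n ltn_add2r.
  suff: has (fun t => t.2 == m.2) l by rewrite has_count.
  by apply/hasP; exists m => /=.
- by move=> t; rewrite mem_filter => /andP[_]; apply: lB.
- by rewrite -[RHS]l0E (split_sum _ id) c0 scale0r add0r.
Qed.

Definition coords (x : V) : seq (K * V) := sval (cid2 (basic_span x)).

Lemma coordsP x : (forall t, t \in coords x -> basic t.2 /\ adle t.2 x).
Proof. by rewrite /coords; case: cid2. Qed.

Lemma coords_sum x : \sum_(t <- coords x) t.1 *: t.2 = x.
Proof. by rewrite /coords; case: cid2. Qed.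

Definition linext (W : lmodType K) (F : V -> W) (x : V) : W :=
  \sum_(t <- coords x) t.1 *: F t.2.

Section LinExt.
Variable W : lmodType K.
Implicit Types F G : V -> W.

(** The expansions of [x], [y] and [a *: x + y] are chosen independently; their formal difference
    [l] sums to zero, and [basic_free] transports this through [F]. *)
Lemma linext_linear F : linear (linext F).
Proof.
move=> a x y; apply/eqP; rewrite -subr_eq0 opprD addrA; apply/eqP.
pose l := coords (a *: x + y) ++ [seq (- a * t.1, t.2) | t <- coords x] ++
  [seq (- t.1, t.2) | t <- coords y].
have lE (W' : lmodType K) (G : V -> W') : \sum_(t <- l) t.1 *: G t.2 =
    linext G (a *: x + y) - a *: linext G x - linext G y.
  rewrite !big_cat !big_map /= addrA; congr (_ + _ + _).
    rewrite /linext -scaleNr scaler_sumr.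
    by apply: eq_bigr => t _; rewrite scalerA.
  by rewrite -sumrN; apply: eq_bigr => t _; rewrite scaleNr.
rewrite -lE; apply: basic_free.
  move=> t; rewrite !mem_cat.
  by case/or3P => [/coordsP[]|/mapP[s /coordsP[bs _] ->]|/mapP[s /coordsP[bs _] ->]].
rewrite (lE _ id) /linext !coords_sum.
by rewrite -addrA -opprD subrr.
Qed.

Lemma linext_basic F b : basic b -> linext F b = F b.
Proof.
move=> bb; pose l := (- 1, b) :: coords b; apply/eqP; rewrite -subr_eq0.
have lE (W' : lmodType K) (G : V -> W') : \sum_(t <- l) t.1 *: G t.2 =
    linext G b - G b by rewrite big_cons /= scaleN1r addrC.
rewrite -lE basic_free // ?(lE _ id) /linext ?coords_sum ?subrr //.
by move=> t; rewrite inE => /orP[/eqP->//|/coordsP[]].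
Qed.

Lemma linext_id (f : V -> W) : linear f -> forall x, f x = linext f x.
Proof.
move=> flin x; pose fL := GRing.isLinear.Build K V W *:%R f flin.
pose g : {linear V -> W} := HB.pack f fL.
rewrite -[in LHS](coords_sum x) -[LHS]/(g _) linear_sum.
by apply: eq_bigr => t _; rewrite linearZ.
Qed.

Lemma linear_eq (f g : V -> W) : linear f -> linear g ->
  (forall b, basic b -> f b = g b) -> forall x, f x = g x.
Proof.
move=> fl gl fg x; rewrite (linext_id fl) (linext_id gl).
by apply: eq_big_seq => t /coordsP[tb _]; rewrite fg.
Qed.

(** The expansion of a vector of [S] uses only basis vectors below it, and these lie in the initial
    segment [S]. *)
Lemma linear_eq_sub (f g : V -> W) : linear f -> linear g ->
  (forall b, basic b -> b \in S -> f b = g b) -> {in S, f =1 g}.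
Proof.
move=> fl gl fg x xS; rewrite (linext_id fl) (linext_id gl).
apply: eq_big_seq => t /coordsP[tb tx]; rewrite fg //.
exact: adle_sub tx xS.
Qed.

Lemma linext_eq F G : (forall b, basic b -> F b = G b) -> linext F =1 linext G.
Proof. by move=> FG x; apply: eq_big_seq => t /coordsP[/FG ->]. Qed.

Lemma linextD a F G x :
  linext (fun b => a *: F b + G b) x = a *: linext F x + linext G x.
Proof.
rewrite /linext scaler_sumr -big_split; apply: eq_bigr => t _ /=.
by rewrite scalerDr !scalerA mulrC.
Qed.

End LinExt.

End AdaptedBasis.

(** * Multilinear functions of lists *)

Section SlotLinear.
Variables (K : fieldType) (V W : lmodType K).
Implicit Types f g : seq V -> W.

(** Multilinearity on words of all lengths at once, that is, a linear map on the tensor algebra of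
    [V]. *)
Definition slotlin f := forall u v a x y,
  f (u ++ (a *: x + y) :: v) = a *: f (u ++ x :: v) + f (u ++ y :: v).

Lemma slotlin_linear f u v : slotlin f -> linear (fun x => f (u ++ x :: v)).
Proof. by move=> fl a x y; apply: fl. Qed.

Lemma slotlin0 f u v : slotlin f -> f (u ++ 0 :: v) = 0.
Proof.
move=> /(_ u v (-1) 0 0); rewrite scaler0 addr0 scaleN1r => {1}->.
exact: addNr.
Qed.

Lemma slotlinD f u v x y : slotlin f ->
  f (u ++ (x + y) :: v) = f (u ++ x :: v) + f (u ++ y :: v).
Proof. by move=> fl; rewrite -[x in LHS]scale1r fl scale1r. Qed.

Lemma slotlinN f u v x : slotlin f -> f (u ++ - x :: v) = - f (u ++ x :: v).
Proof.
by move=> fl; rewrite -[- x]addr0 -scaleN1r fl slotlin0 // addr0 scaleN1r.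
Qed.

Lemma slotlin_catl f u : slotlin f -> slotlin (fun w => f (u ++ w)).
Proof. by move=> fl u' v' a x y; rewrite !catA fl. Qed.

Lemma slotlin_catr f v : slotlin f -> slotlin (fun w => f (w ++ v)).
Proof. by move=> fl u' v' a x y; rewrite -!catA fl. Qed.

Lemma slotlin_cons f b : slotlin f -> slotlin (fun w => f (b :: w)).
Proof. exact: (@slotlin_catl f [:: b]). Qed.

Lemma slotlinB f g : slotlin f -> slotlin g -> slotlin (fun w => f w - g w).
Proof.
by move=> fl gl u v a x y; rewrite fl gl scalerBr opprD addrACA.
Qed.

Variable S : {pred V}.

Lemma slotlin_eq n f g : slotlin f -> slotlin g ->
  (forall w, all (basic S) w -> size w = n -> f w = g w) ->
  forall w, size w = n -> f w = g w.
Proof.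
move=> fl gl fg.
suff H w u : all (basic S) u -> size (u ++ w) = n -> f (u ++ w) = g (u ++ w).
  by move=> w; apply: (H w [::]).
elim: w u => [|x w IHw] u ub; first by rewrite cats0; apply: fg.
rewrite size_cat /= => szn.
apply: (linear_eq (S := S) (f := fun x => f (u ++ x :: w))
  (g := fun x => g (u ++ x :: w))) => [||b bb]; try exact: slotlin_linear.
rewrite -!cat_rcons; apply: IHw; last by rewrite size_cat size_rcons addSnnS.
by rewrite all_rcons bb.
Qed.

Fixpoint mlext f (w : seq V) {struct w} : W :=
  if w is x :: w' then linext S (fun b => mlext (fun v => f (b :: v)) w') x
  else f [::].

Lemma mlext_basic f w : all (basic S) w -> mlext f w = f w.
Proof.
elim: w f => //= x w IHw f /andP[bx bw].
by rewrite linext_basic // IHw.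
Qed.

Lemma mlext_slotlin f : slotlin (mlext f).
Proof.
move=> u v a x y; elim: u f => [|b u IHu] f /=; first exact: linext_linear.
by rewrite -linextD; apply: linext_eq => c _; rewrite IHu.
Qed.

End SlotLinear.

(** * The Poincare-Birkhoff-Witt theorem *)

Lemma lieDl (K : fieldType) (h : lieAlgType K) (u v w : h) :
  lie (u + v) w = lie u w + lie v w.
Proof. by have := lie_linearl w 1 u v; rewrite !scale1r. Qed.

Lemma lieDr (K : fieldType) (h : lieAlgType K) (u v w : h) :
  lie w (u + v) = lie w u + lie w v.
Proof. by have := lie_linearr w 1 u v; rewrite !scale1r. Qed.

Lemma lie_antisym (K : fieldType) (h : lieAlgType K) (x y : h) :
  lie x y = - lie y x.
Proof.
have := liexx (x + y); rewrite lieDl !lieDr !liexx add0r addr0 => /eqP.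
by rewrite addr_eq0 => /eqP.
Qed.

Lemma lieNr (K : fieldType) (h : lieAlgType K) (x y : h) :
  lie x (- y) = - lie x y.
Proof.
apply/eqP; rewrite -addr_eq0 -lieDr addNr.
have := lieDr 0 0 x; rewrite addr0 -{1}[lie x 0]addr0 => /addrI <-.
exact: eqxx.
Qed.

(** * Sorting words at the cost of brackets *)

Section Sorting.
Variables (K : fieldType) (h : lieAlgType K) (N : lmodType K) (S : {pred h}).
Local Notation le := (adle S).
Implicit Types (f g : seq h -> N) (u v w : seq h) (a b : h).

Fixpoint linsert a v :=
  if v is b :: v' then if le a b then a :: v else b :: linsert a v'
  else [:: a].

Definition lsort v := foldr linsert [::] v.

Lemma perm_linsert a v : perm_eq (linsert a v) (a :: v).
Proof.
elim: v => //= b v IHv; case: ifP => // _.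
apply: (@perm_trans _ (b :: a :: v)); first by rewrite perm_cons.
exact/permPl/(perm_catCA [:: b] [:: a] v).
Qed.

Lemma perm_lsort v : perm_eq (lsort v) v.
Proof.
elim: v => //= a v IHv; rewrite (permPl (perm_linsert _ _)).
by rewrite perm_cons.
Qed.

Lemma size_lsort v : size (lsort v) = size v.
Proof. exact/perm_size/perm_lsort. Qed.

Lemma linsert_sorted a v : sorted le v -> sorted le (linsert a v).
Proof.
elim: v => //= b v IHv bv; case: ifP => [ab|/negbT ab] /=; first by rewrite ab.
rewrite -adltNle in ab; case/andP: ab => ba _.
have le_tr : transitive le by apply: adle_trans.
rewrite path_sortedE // IHv ?(path_sorted bv) // andbT.
rewrite (perm_all _ (perm_linsert _ _)) /= ba.
by move: bv; rewrite path_sortedE // => /andP[].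
Qed.

Lemma lsort_sorted v : sorted le (lsort v).
Proof. by elim: v => //= a v; apply: linsert_sorted. Qed.

Lemma linsertC a b v : linsert a (linsert b v) = linsert b (linsert a v).
Proof.
wlog ab : a b / le a b.
  by move=> H; case/orP: (adle_total S a b) => /H.
have [<-//|nab] := eqVneq a b.
have nba : le b a = false.
  by apply/negbTE; rewrite -adltNle /adlt ab.
elim: v => [|c v IHv] /=; first by rewrite ab nba.
have [bc|nbc] := boolP (le b c).
  by rewrite (adle_trans ab bc) /= ab nba bc.
rewrite /=; case: (le a c); rewrite /= ?nba /= (negPf nbc) //.
by rewrite IHv.
Qed.

Lemma lsort_swap u a b v : lsort (u ++ a :: b :: v) = lsort (u ++ b :: a :: v).
Proof. by rewrite /lsort !foldr_cat /= linsertC. Qed.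

(* The difference between [f (u ++ a :: v)] and [f (u ++ linsert a v)] when [f]
   turns commutators of letters into brackets. *)
Fixpoint insert_cost f u a v : N :=
  if v is b :: v' then
    if le a b then 0
    else f (u ++ lie a b :: v') + insert_cost f (rcons u b) a v'
  else 0.

Fixpoint sort_cost f u w : N :=
  if w is a :: w' then sort_cost f (rcons u a) w' + insert_cost f u a (lsort w')
  else 0.

(** A bracket merges two letters, so only words one letter shorter than [u ++ a :: v] enter. This
    permits recursion on length. *)
Lemma eq_insert_cost f g u a v :
  (forall w, size w = (size u + size v)%N -> f w = g w) ->
  insert_cost f u a v = insert_cost g u a v.
Proof.
elim: v u => //= b v IHv u fg; case: ifP => // _; congr (_ + _).
  by apply: fg; rewrite size_cat.
by apply: IHv => w; rewrite size_rcons addSnnS; apply: fg.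
Qed.

Lemma eq_sort_cost f g u v :
  (forall w, (size w).+1 = (size u + size v)%N -> f w = g w) ->
  sort_cost f u v = sort_cost g u v.
Proof.
elim: v u => //= a v IHv u fg; congr (_ + _).
  by apply: IHv => w; rewrite size_rcons addSnnS; apply: fg.
by apply: eq_insert_cost => w; rewrite size_lsort => wE; apply: fg; lia.
Qed.

(** The relation x y - y x = [x, y] of the enveloping algebra, for words of length [k] only, so that
    it can be proved by induction on [k]. *)
Definition lie_rel f k := forall u x y v, (size u + size v + 2)%N = k ->
  f (u ++ x :: y :: v) = f (u ++ y :: x :: v) + f (u ++ lie x y :: v).

Section LieRel.
Variables (f : seq h -> N) (k : nat).
Hypothesis (fk : lie_rel f k).

Lemma lie_rel_insert u a v : (size u + size v).+1 = k ->
  f (u ++ a :: v) = f (u ++ linsert a v) + insert_cost f u a v.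
Proof.
elim: v u => [|b v IHv] u /= szk; first by rewrite addr0.
case: ifP => _; first by rewrite addr0.
rewrite fk; last by move: szk; lia.
rewrite -(cat_rcons b u (a :: v)) IHv; last by rewrite size_rcons; lia.
by rewrite cat_rcons; zmodule.
Qed.

Lemma lie_rel_sort u w : (size u + size w)%N = k ->
  f (u ++ w) = f (u ++ lsort w) + sort_cost f u w.
Proof.
elim: w u => [|a w IHw] u /= szk; first by rewrite addr0.
rewrite -cat_rcons IHw; last by rewrite size_rcons; lia.
rewrite cat_rcons lie_rel_insert; last by rewrite size_lsort; lia.
by zmodule.
Qed.

(** Each term of the cost changes by [f] at the same word with [lie a c] replacing the two letters;
    these changes add up to the cost of inserting [b] behind [u ++ lie a c :: t]. *)
Lemma insert_cost_swap u a c t b v : (size u + size t + size v + 2)%N = k ->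
  insert_cost f (u ++ a :: c :: t) b v =
  insert_cost f (u ++ c :: a :: t) b v +
    (f (u ++ lie a c :: t ++ b :: v) - f (u ++ lie a c :: t ++ linsert b v)).
Proof.
elim: v t => [|d v IHv] t /= szk; first by rewrite subrr addr0.
case: ifP => _; first by rewrite subrr addr0.
rewrite !rcons_cat /= IHv ?size_rcons; last by move: szk; lia.
rewrite -!catA /= fk; last by rewrite size_cat /=; move: szk; lia.
have := @fk (u ++ lie a c :: t) b d v.
rewrite -!catA /= => ->; last by rewrite size_cat /=; move: szk; lia.
by rewrite !cat_rcons; zmodule.
Qed.

Lemma sort_cost_swap u a b t v : (size u + size t + size v + 1)%N = k ->
  sort_cost f (u ++ a :: b :: t) v = sort_cost f (u ++ b :: a :: t) v +
    (f (u ++ lie a b :: t ++ v) - f (u ++ lie a b :: t ++ lsort v)).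
Proof.
elim: v t => [|x v IHv] t /= szk; first by rewrite subrr addr0.
rewrite !rcons_cat /= IHv ?size_rcons; last by move: szk; lia.
rewrite insert_cost_swap ?size_lsort; last by move: szk; lia.
by rewrite !cat_rcons; zmodule.
Qed.

Hypothesis fl : slotlin f.

(* The two ways of sorting [x y z] differ by the Jacobi identity. *)
Lemma insert_cost_diamond u a b v : (size u + size v + 1)%N = k ->
  insert_cost f (rcons u a) b v + insert_cost f u a (linsert b v) =
  insert_cost f (rcons u b) a v + insert_cost f u b (linsert a v) +
    f (u ++ lie a b :: v).
Proof.
wlog ab : a b / le b a.
  move=> H; case/orP: (adle_total S a b) => [/H E szk|/H //].
  by rewrite lie_antisym slotlinN // (E szk); zmodule.
have [<-//|nab] := eqVneq b a => szk.
  by rewrite liexx slotlin0 // addr0.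
have nba : le a b = false.
  by apply/negbTE; rewrite -adltNle /adlt ab.
elim: v u szk => [|c v IHv] u szk /=.
  by rewrite ab nba; zmodule.
have [bc|nbc] := boolP (le b c).
  rewrite /= nba; case: (boolP (le a c)) => [ac|nac] /=.
    by rewrite ab; zmodule.
  by rewrite bc; zmodule.
have nac : le a c = false.
  by apply: contraNF nbc => ac; apply: adle_trans ab ac.
(* The critical case c < b < a: both insertions pass [c], the induction hypothesis applies behind
   [c], and the remaining double brackets cancel by the Jacobi identity. *)
rewrite nac /= nac (negPf nbc).
have szk' : (size (rcons u c) + size v + 1)%N = k.
  by move: szk; rewrite size_rcons /=; lia.
have szk2 : (size u + size (@nil h) + size v + 2)%N = k.
  by move: szk => /=; lia.
have := IHv _ szk'.
have := insert_cost_swap a c b szk2; have := insert_cost_swap b c a szk2.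
have szk3 : (size u + size v + 2)%N = k by move: szk => /=; lia.
have := fk a (lie b c) szk3; have := fk (lie a c) b szk3.
have := fk (lie a b) c szk3.
have := lie_jacobi a b c; rewrite -!cats1 -!catA /=.
move=> /(congr1 (fun x => f (u ++ x :: v))) /=.
rewrite (lie_antisym c a) lieNr (lie_antisym (lie a c) b) (lie_antisym (lie a b) c).
rewrite !slotlinD // slotlin0 // !slotlinN // => /eqP.
rewrite addr_eq0 => /eqP/(canRL (addrK _)) -> -> -> -> -> ->.
by move=> /(canRL (addrK _)) ->; zmodule.
Qed.

End LieRel.
End Sorting.

(** The consistency behind the Poincare-Birkhoff-Witt theorem: relations on words of length [k] make
    the total cost on words of length k + 1 compatible with a swap. Past the common prefix [u] this
    follows from the diamond and [sort_cost_swap]. *)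
Lemma sort_cost_step (K : fieldType) (h : lieAlgType K) (N : lmodType K)
    (S : {pred h}) (f : seq h -> N) k w u a b v :
  lie_rel f k -> slotlin f -> (size w + size u + size v + 1)%N = k ->
  sort_cost S f w (u ++ a :: b :: v) =
  sort_cost S f w (u ++ b :: a :: v) + f (w ++ u ++ lie a b :: v).
Proof.
move=> fk fl; elim: u w => [|c u IHu] w /= szk; last first.
  rewrite (lsort_swap S u a b v) IHu; last by rewrite size_rcons; move: szk; lia.
  by rewrite cat_rcons; zmodule.
rewrite -!cats1 -!catA /=.
have := @sort_cost_swap _ _ _ S _ _ fk w a b [::] v => /= ->; last first.
  by move: szk => /=; lia.
have := @insert_cost_diamond _ _ _ S _ _ fk fl w a b (lsort S v).
rewrite size_lsort -!cats1 => E.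
have {}E := E ltac:(move: szk => /=; lia).
by move/(canRL (addrK _)): E => ->; zmodule.
Qed.

Lemma slotlin_add (K : fieldType) (V W : lmodType K) (f g : seq V -> W) :
  slotlin f -> slotlin g -> slotlin (fun w => f w + g w).
Proof. by move=> fl gl u v a x y; rewrite fl gl scalerDr addrACA. Qed.

Lemma lie_rel_basic (K : fieldType) (h : lieAlgType K) (N : lmodType K)
    (S : {pred h}) (f : seq h -> N) k : slotlin f ->
  (forall (u : seq h) (a b : h) (v : seq h), all (basic S) u -> basic S a -> basic S b ->
    all (basic S) v -> (size u + size v + 2)%N = k ->
    f (u ++ a :: b :: v) = f (u ++ b :: a :: v) + f (u ++ lie a b :: v)) ->
  lie_rel f k.
Proof.
move=> fl fb u x y v szk.
have fl1 t := slotlin_catl t fl; have fl2 t := slotlin_catr t fl.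
apply: (slotlin_eq (S := S) (n := size u) (f := fun u => f (u ++ x :: y :: v))
  (g := fun u => f (u ++ y :: x :: v) + f (u ++ lie x y :: v))) => //.
  exact: slotlin_add.
move=> u' ub szu; rewrite -szu in szk; move: u' ub szk {szu} => {}u ub szk.
have fl3 t : slotlin (fun v => f (u ++ t ++ v)).
  by have := fl1 (u ++ t); under eq_fun do rewrite -catA.
apply: (slotlin_eq (S := S) (n := size v) (f := fun v => f (u ++ [:: x; y] ++ v))
  (g := fun v => f (u ++ [:: y; x] ++ v) + f (u ++ [:: lie x y] ++ v))) => //.
  exact: slotlin_add.
move=> v' vb szv; rewrite -szv in szk; move: v' vb szk {szv} => {}v vb szk /=.
have linD (V W : lmodType K) (q r : V -> W) :
    linear q -> linear r -> linear (fun x => q x + r x).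
  by move=> ql rl a z t; rewrite ql rl scalerDr addrACA.
have lin1 z : linear (fun x => f (u ++ x :: z :: v)) by apply: slotlin_linear.
have lin2 z : linear (fun x => f (u ++ z :: x :: v)).
  by move=> a s t; have := fl (rcons u z) v a s t; rewrite !cat_rcons.
have lin3 : linear (fun x => f (u ++ x :: v)) by apply: slotlin_linear.
move: x; apply: (linear_eq (S := S)) => // [|a ab].
  by apply: linD => // c s t; rewrite lie_linearl lin3.
move: y; apply: (linear_eq (S := S)) => // [|b bb].
  by apply: linD => // c s t; rewrite lie_linearr lin3.
exact: fb.
Qed.

Lemma slotlin_comp (K : fieldType) (V W W' : lmodType K) (f : seq V -> W)
    (q : W -> W') : linear q -> slotlin f -> slotlin (q \o f).
Proof. by move=> ql fl u v a x y; rewrite /= fl ql. Qed.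

Section LactTheory.
Variables (K : fieldType) (g : lieAlgType K) (M : lieModType g).

Lemma lactDr (x : g) (m n : M) : lact x (m + n) = lact x m + lact x n.
Proof. by have := lact_linearr x 1 m n; rewrite !scale1r. Qed.

Lemma lact0r (x : g) : lact x (0 : M) = 0.
Proof. by apply: (addrI (lact x 0)); rewrite -lactDr !addr0. Qed.

Lemma lactNr (x : g) (m : M) : lact x (- m) = - lact x m.
Proof. by apply/eqP; rewrite -addr_eq0 -lactDr addNr lact0r. Qed.

End LactTheory.

(** * Functions on the enveloping algebra with prescribed values at normal words *)

Section PBW.
Variables (K : fieldType) (p h : lieAlgType K) (iota : {lieMorphism p -> h}).
Hypothesis iota_inj : injective iota.
Variable N : lieModType p.

Local Notation S := (lie_im iota).
Implicit Types (f : seq h -> N) (u v w : seq h).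

Definition lie_preim (y : h) : p :=
  if pselect (exists x, iota x = y) is left yS then sval (cid yS) else 0.

(** [lie_preim] is zero off the image and so in general not linear; extending it from the basis
    gives a linear left inverse of [iota]. *)
Definition retr : h -> p := linext S lie_preim.

Lemma retr_linear : linear retr.
Proof. exact: linext_linear. Qed.

Lemma retrK : cancel iota retr.
Proof.
move=> x; apply: iota_inj.
have := @linear_eq_sub K h S h (fun y => iota (retr y)) id.
apply=> [a u v|//|b bb /lie_imP bS|].
- by rewrite retr_linear linearP.
- by rewrite /retr linext_basic // /lie_preim; case: pselect => // e; case: cid.
- by apply/lie_imP; exists x.
Qed.

Lemma iota_retr y : y \in S -> iota (retr y) = y.
Proof. by move=> /lie_imP[x <-]; rewrite retrK. Qed.

Definition act_rel f k := forall x w, (size w).+1 = k ->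
  f (iota x :: w) = lact x (f w).

(** A leading letter in [S] of a sorted word is pulled out as an action. If the first letter is not
    in [S], none is, since [S] comes first in the order, and [s] decides. *)
Definition pbw_lead (s f : seq h -> N) v : N :=
  if v is b :: v' then if b \in S then lact (retr b) (f v') else s v else s v.

(* On words of length [k], the function on [U(h)] whose value at a normal word
   [w] is [s w]. *)
Fixpoint pbw_stage s k : seq h -> N :=
  mlext S (if k is k'.+1 then fun w =>
    sort_cost S (pbw_stage s k') [::] w + pbw_lead s (pbw_stage s k') (lsort S w)
  else s).

Definition pbw s w := pbw_stage s (size w) w.

Lemma pbw_slotlin s : slotlin (pbw s).
Proof.
move=> u v a x y; rewrite /pbw !size_cat /=.
by case: (size u + _)%N => [|k]; apply: mlext_slotlin.
Qed.

Lemma pbwE s w : all (basic S) w ->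
  pbw s w = sort_cost S (pbw s) [::] w + pbw_lead s (pbw s) (lsort S w).
Proof.
case: w => [|a w] wb; first by rewrite /pbw /= add0r.
rewrite {1}/pbw -[size (a :: w)]/(size w).+1 [LHS]mlext_basic //.
congr (_ + _); first by apply: eq_sort_cost => t [szt]; rewrite /pbw szt.
rewrite /pbw_lead; have := size_lsort S (a :: w).
by case: lsort => //= b v [szv]; rewrite /pbw szv.
Qed.

Lemma insert_cost_act f k x u a v :
  act_rel f k -> (size u + size v + 1)%N = k ->
  insert_cost S f (iota x :: u) a v = lact x (insert_cost S f u a v).
Proof.
move=> fk; elim: v u => [|b v IHv] u szk /=; first by rewrite lact0r.
case: ifP => _; first by rewrite lact0r.
rewrite lactDr fk ?IHv ?size_cat ?size_rcons //=; move: szk => /=; lia.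
Qed.

Lemma sort_cost_act f k x u w :
  act_rel f k -> (size u + size w)%N = k ->
  sort_cost S f (iota x :: u) w = lact x (sort_cost S f u w).
Proof.
move=> fk; elim: w u => [|a w IHw] u szk /=; first by rewrite lact0r.
rewrite lactDr (insert_cost_act _ _ fk) ?size_lsort ?IHw ?size_rcons //;
  move: szk => /=; lia.
Qed.

(** Both relations are proved together by induction on [k]: sorting costs and leading terms at
    length k + 1 only use [pbw s] at length [k]. The Lie relation is then [sort_cost_step]. *)
Lemma pbw_rel s k : lie_rel (pbw s) k /\ act_rel (pbw s) k.
Proof.
have fl := pbw_slotlin s; have fE := @pbwE s; set f := pbw s in fl fE *.
elim: k => [|k [fk fa]].
  by split=> [u x y v|x w //]; rewrite addn2.
have lact_lin x : linear (lact x : N -> N) by apply: lact_linearr.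
split=> [|x w [szk]].
  apply: (lie_rel_basic (S := S)) => // u a b v ub ab bb vb szk.
  have [w1 w2] : all (basic S) (u ++ a :: b :: v) /\ all (basic S) (u ++ b :: a :: v).
    by rewrite !all_cat /= ub ab bb vb.
  rewrite (fE _ w1) (fE _ w2) (lsort_swap S u a b v).
  by rewrite (sort_cost_step _ _ _ fk fl) /=; [zmodule|move: szk; lia].
have fx_lin y : slotlin (fun w => lact (retr y) (f w)).
  exact: (slotlin_comp (lact_lin (retr y)) fl).
(* Both sides are linear in [iota x] over [S], so [iota x] may be replaced by a basis vector [a] in
   [S]. *)
rewrite -[x in RHS]retrK; have: iota x \in S by apply/lie_imP; exists x.
move: (iota x) => {x}.
apply: (linear_eq_sub (f := fun y => f (y :: w))
  (g := fun y => lact (retr y) (f w))) => [||a ab aS].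
- exact: (@slotlin_linear _ _ _ f [::] w).
- by move=> c y z; rewrite retr_linear lact_linearl.
apply: (slotlin_eq (S := S) (n := k) (f := fun w => f (a :: w))
  (g := fun w => lact (retr a) (f w))) => // [|{szk}w wb szk].
  exact: slotlin_cons.
move: (retr a) (iota_retr aS) => x xa.
rewrite fE /= ?ab // -xa (sort_cost_act (k := k)) // xa.
have -> : f w = f (lsort S w) + sort_cost S f [::] w.
  exact: (lie_rel_sort S fk (u := [::])).
suff E v : size v = k -> insert_cost S f [::] a v +
    pbw_lead s f (linsert S a v) = lact x (f v).
  by rewrite lactDr -E ?size_lsort //; zmodule.
case: v => [|c v] /= szv; first by rewrite aS add0r -xa retrK.
case: ifP => [ac|nac] /=; first by rewrite aS add0r -xa retrK.
(* A letter [c] passed by [a] is smaller, hence also in [S]; both letters then act on [N], and the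
   bracket term is absorbed by [lact_lie]. *)
have cS : c \in S.
  by case/orP: (adle_total S a c) => [|/adle_sub]; [rewrite nac|apply].
rewrite cS; move: (retr c) (iota_retr cS) => y yc.
rewrite -yc (insert_cost_act (k := k)) ?addn1 // yc.
have -> : insert_cost S f [::] a v = f (a :: v) - f (linsert S a v).
  have := lie_rel_insert S fk (u := [::]) a (v := v).
  by rewrite /= szv => -> //; zmodule.
rewrite -xa -yc -lie_morph !fa // lact_lie lactDr lactNr.
by zmodule.
Qed.

End PBW.

(** * The coinduced module *)

Section SortMore.
Variables (K : fieldType) (h : lieAlgType K) (N : lmodType K) (S : {pred h}).
Local Notation le := (adle S).
Implicit Types (f : seq h -> N) (u v w : seq h) (a b : h).

Lemma lsort_perm v w : perm_eq v w -> lsort S v = lsort S w.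
Proof.
move=> vw; apply: (sorted_eq (leT := le)); try exact: lsort_sorted.
- exact: adle_trans.
- exact: adle_anti.
- by rewrite (permPl (perm_lsort _ _)) perm_sym (permPl (perm_lsort _ _)) perm_sym.
Qed.

Lemma linsert_path a v : path le a v -> linsert S a v = a :: v.
Proof. by case: v => //= b v /andP[->]. Qed.

Lemma sorted_lsort v : sorted le v -> lsort S v = v.
Proof.
elim: v => //= a v IHv av; rewrite IHv ?(path_sorted av) //.
exact: linsert_path.
Qed.

Lemma sort_cost_sorted f u v : sorted le v -> sort_cost S f u v = 0.
Proof.
elim: v u => //= a v IHv u av; have sv := path_sorted av.
rewrite IHv // sorted_lsort // add0r.
by case: v av {IHv sv} => //= b v /andP[->].
Qed.

Lemma sort_cost0 f u v :
  (forall w, (size w).+1 = (size u + size v)%N -> f w = 0) ->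
  sort_cost S f u v = 0.
Proof.
move=> f0; rewrite (@eq_sort_cost _ _ _ S f (fun=> 0)) // => {f f0}.
elim: v u => //= a v IHv u; rewrite IHv add0r.
by elim: (lsort S v) (u) => //= b t IHt u'; case: ifP => // _; rewrite IHt addr0.
Qed.

(** Sorting costs involve shorter words, where [f] vanishes. So [f] is symmetric in degree [k], as
    the associated graded algebra is commutative. *)
Lemma lead_perm f k v w : lie_rel f k -> (forall t, (size t < k)%N -> f t = 0) ->
  size v = k -> perm_eq v w -> f v = f w.
Proof.
move=> fk f0 szv vw.
have fsort t : size t = k -> f t = f (lsort S t).
  move=> szt; rewrite [LHS](lie_rel_sort S fk (u := [::])) // sort_cost0 ?addr0 //.
  by move=> t' szt'; apply: f0; rewrite -szt -[size t]add0n -szt'.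
by rewrite (fsort v) // (lsort_perm vw) -fsort // -szv (perm_size vw).
Qed.

End SortMore.

Section Coinduced.
Variables (K : fieldType) (p h : lieAlgType K) (iota : {lieMorphism p -> h}).
Variable N : lieModType p.
Implicit Types (u v w : seq h).

Definition coind_pred : {pred seq h -> N} := [pred f | `[<
  [/\ slotlin f, forall k, lie_rel f k & forall k, act_rel iota f k] >]].

Lemma coind_submod_closed : submod_closed coind_pred.
Proof.
split.
  apply/asboolP; split=> [u v a x y|k u x y v _|k x w _] /=.
  - by rewrite scaler0 addr0.
  - by rewrite addr0.
  - by rewrite lact0r.
move=> c f g /asboolP[fl fr fa] /asboolP[gl gr ga]; apply/asboolP.
have E w : (c *: f + g) w = c *: f w + g w by [].
split=> [u v a x y|k u x y v szk|k x w szk]; rewrite !E.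
- by rewrite fl gl !scalerDr !scalerA [c * a]mulrC addrACA.
- by rewrite (fr k) // (gr k) // scalerDr addrACA.
- by rewrite (fa k) // (ga k) // lact_linearr.
Qed.

HB.instance Definition _ :=
  GRing.isSubmodClosed.Build K (seq h -> N) coind_pred coind_submod_closed.

(* [Hom_U(p)(U(h), N)], a linear map on [U(h)] being given by its values on
   words in [h]. *)
Record coind := Coind { coind_fun :> seq h -> N; _ : coind_fun \in coind_pred }.

HB.instance Definition _ := [isSub for coind_fun].
HB.instance Definition _ := [Choice of coind by <:].
HB.instance Definition _ := [SubChoice_isSubLmodule of coind by <:].

Lemma coind_slotlin (f : coind) : slotlin f.
Proof. by case: f => f /= /asboolP[]. Qed.

Lemma coind_lie (f : coind) k : lie_rel f k.
Proof. by case: f => f /= /asboolP[]. Qed.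

Lemma coind_act_rel (f : coind) k : act_rel iota f k.
Proof. by case: f => f /= /asboolP[]. Qed.

Lemma coind_iota (f : coind) x w : f (iota x :: w) = lact x (f w).
Proof. exact: (coind_act_rel f (k := (size w).+1)). Qed.

Lemma coindD (f g : coind) w : (f + g) w = f w + g w. Proof. by []. Qed.
Lemma coindN (f : coind) w : (- f) w = - f w. Proof. by []. Qed.
Lemma coindZ a (f : coind) w : (a *: f) w = a *: f w. Proof. by []. Qed.
Lemma coind0 w : (0 : coind) w = 0. Proof. by []. Qed.

Lemma coind_shift_subproof (y : h) (f : coind) :
  (fun w => f (rcons w y)) \in coind_pred.
Proof.
apply/asboolP; split=> [u v a s t|k u s t v _|k x w _].
- by rewrite !rcons_cat /= coind_slotlin.
- by rewrite !rcons_cat /= (coind_lie f (k := size u + size (rcons v y) + 2)).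
- by rewrite /= coind_iota.
Qed.

Definition coind_shift y f : coind := Coind (coind_shift_subproof y f).

Fact coind_shift_linearl f : linear (coind_shift^~ f).
Proof.
move=> a x y; apply: val_inj; apply/funext => w /=.
rewrite -[RHS]/(a *: f _ + f _) -!cats1; exact: coind_slotlin.
Qed.

Fact coind_shift_linearr x : linear (coind_shift x).
Proof. by move=> a f g; apply: val_inj. Qed.

Fact coind_shift_lie x y f : coind_shift (lie x y) f =
  coind_shift x (coind_shift y f) - coind_shift y (coind_shift x f).
Proof.
apply: val_inj; apply/funext => w /=.
rewrite -[RHS]/(f _ - f _) -!cats1 -!catA /=.
by rewrite [in X in X - _](coind_lie f (k := size w + 2)) ?addn0 //; zmodule.
Qed.

HB.instance Definition _ := Lmodule_isLieModule.Build K h coind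
  coind_shift_linearl coind_shift_linearr coind_shift_lie.

Local Notation S := (lie_im iota).

Lemma coind_perm (f : coind) v w : (forall t, (size t < size v)%N -> f t = 0) ->
  perm_eq v w -> f v = f w.
Proof. by move=> f0; apply: (lead_perm S (@coind_lie f _) f0). Qed.

(** The letter of [S] moves to the front, where it acts on the value at a shorter word, which is
    zero. *)
Lemma coind_lead_im (f : coind) x w :
  (forall t, (size t < size w)%N -> f t = 0) -> x \in S -> x \in w -> f w = 0.
Proof.
move=> f0 /lie_imP[y <-] yw; rewrite (coind_perm f0 (perm_to_rem yw)).
by rewrite coind_iota f0 ?lact0r // size_rem // prednK //; case: (w) yw.
Qed.

(** For injective [iota], these words are a basis of $U(\mathfrak h)$ as a left $U(\mathfrak
    p)$-module, by Poincare-Birkhoff-Witt. *)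
Definition normal_word w := [&& all (basic S) w, sorted (adle S) w &
  all [predC S] w].

(** Induction on length: once [f] vanishes on shorter words, a basis word may be sorted, and it is
    then normal unless it has a letter in [S]. *)
Lemma coind_vanish (f : coind) k :
  (forall w, normal_word w -> (size w <= k)%N -> f w = 0) ->
  forall w, (size w <= k)%N -> f w = 0.
Proof.
move=> f0 w; have [n] := ubnP (size w); elim: n w => // n IHn w szn szk.
apply: (slotlin_eq (S := S) (n := size w) (g := fun=> 0)) => //.
- exact: coind_slotlin.
- by move=> *; rewrite scaler0 addr0.
move=> v vb szv; rewrite -szv in szn szk.
have lt0 t : (size t < size v)%N -> f t = 0.
  by move=> tv; apply: IHn; [apply: leq_trans tv _|apply: leq_trans (ltnW tv) _].
have pv : perm_eq v (lsort S v) by rewrite perm_sym perm_lsort.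
have [/allP nS|/allPn[x xv]] := boolP (all [predC S] v); last first.
  by rewrite negbK => xS; apply: coind_lead_im xS xv.
rewrite (coind_perm lt0 pv) f0 ?size_lsort //.
by rewrite /normal_word -!(perm_all _ pv) vb lsort_sorted; apply/allP.
Qed.

Lemma coind_eq (f g : coind) :
  (forall w, normal_word w -> f w = g w) -> f = g.
Proof.
move=> fg; apply: val_inj; apply/funext => w /=.
apply/eqP; rewrite -subr_eq0 -coindN -coindD; apply/eqP.
apply: (coind_vanish (k := size w)) => // v vn _.
by rewrite coindD coindN fg // subrr.
Qed.

Hypothesis iota_inj : injective iota.

Lemma pbw_coind s : pbw iota s \in coind_pred.
Proof.
apply/asboolP; split; first exact: pbw_slotlin.
  by move=> k; have [] := pbw_rel iota_inj s k.
by move=> k; have [] := pbw_rel iota_inj s k.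
Qed.

Definition coind_of s : coind := Coind (pbw_coind s).

(** A normal word has no sorting cost and no letter in [S]. Together with [coind_eq], elements of
    the coinduced module are exactly the functions on normal words. *)
Lemma coind_of_normal s w : normal_word w -> coind_of s w = s w.
Proof.
case/and3P => wb ws wS; rewrite /= pbwE // sort_cost_sorted // add0r.
rewrite sorted_lsort //; case: w wS {wb ws} => //= b w /andP[bS _].
by rewrite (negPf bS).
Qed.

End Coinduced.

(* Conversion tests between two instances of [pbw] are very costly. *)
Opaque coind_of.

(** * Cochains as functions of lists *)

Section Alternating.
Variables (K : fieldType) (V W : lmodType K).
Implicit Types (c : seq V -> W) (u v w : seq V) (x y : V).

(** Only adjacent repetitions are demanded; with multilinearity this gives all of them,
    [lalt_uniq]. *)
Definition lalt c := forall u x v, c (u ++ x :: x :: v) = 0.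

Lemma lalt_cons c y : lalt c -> lalt (fun t => c (y :: t)).
Proof. by move=> ca u; apply: (ca (y :: u)). Qed.

Lemma lalt_antisym c u x y v : slotlin c -> lalt c ->
  c (u ++ x :: y :: v) = - c (u ++ y :: x :: v).
Proof.
move=> cl ca; apply/eqP; rewrite -addr_eq0; apply/eqP.
have := ca u (x + y) v; rewrite slotlinD //.
rewrite -![u ++ _ :: (x + y) :: v]cat_rcons !slotlinD // !cat_rcons !ca.
by rewrite add0r addr0.
Qed.

Lemma lalt_move c u x v : slotlin c -> lalt c ->
  c (x :: u ++ v) = 0 -> c (u ++ x :: v) = 0.
Proof.
elim: u c => //= b u IHu c cl ca c0.
apply: (IHu _ (slotlin_cons b cl) (lalt_cons b ca)).
by rewrite (lalt_antisym [::]) //= c0 oppr0.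
Qed.

Lemma lalt_dup c x v : slotlin c -> lalt c -> x \in v -> c (x :: v) = 0.
Proof.
move=> cl ca; case/splitPr => u t; rewrite -cat_cons.
by apply: lalt_move => //=; apply: (ca [::]).
Qed.

Lemma lalt_uniq c v : slotlin c -> lalt c -> ~~ uniq v -> c v = 0.
Proof.
elim: v c => //= x v IHv c cl ca; rewrite negb_and negbK => /orP[xv|nv].
  exact: lalt_dup.
exact: (IHv _ (slotlin_cons x cl) (lalt_cons x ca)).
Qed.

End Alternating.

(** * Cartan calculus on list cochains *)

Section ListCochains.
Variables (K : fieldType) (g : lieAlgType K) (M : lieModType g).
Implicit Types (c : seq g -> M) (u v w : seq g) (x y z : g).

(* [sum_j c (v_1 .. [x, v_j] .. v_n)] *)
Fixpoint lder x c v {struct v} : M :=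
  if v is y :: v' then c (lie x y :: v') + lder x (fun t => c (y :: t)) v'
  else 0.

Definition lLie x c v : M := lact x (c v) - lder x c v.

(* The Chevalley-Eilenberg differential, defined by Cartan's formula
   [iota_x d = L_x - d iota_x]. *)
Fixpoint ldiff c v {struct v} : M :=
  if v is x :: v' then lLie x c v' - ldiff (fun t => c (x :: t)) v' else 0.

Lemma lder_lin x a c c' v :
  lder x (fun t => a *: c t + c' t) v = a *: lder x c v + lder x c' v.
Proof.
elim: v c c' => [|y v IHv] c c' /=; first by rewrite scaler0 addr0.
by rewrite IHv scalerDr addrACA.
Qed.

Lemma lLie_lin x a c c' v :
  lLie x (fun t => a *: c t + c' t) v = a *: lLie x c v + lLie x c' v.
Proof.
by rewrite /lLie lder_lin lact_linearr scalerBr opprD addrACA.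
Qed.

Lemma ldiff_lin a c c' v :
  ldiff (fun t => a *: c t + c' t) v = a *: ldiff c v + ldiff c' v.
Proof.
elim: v c c' => [|y v IHv] c c' /=; first by rewrite scaler0 addr0.
by rewrite IHv lLie_lin [in RHS]scalerBr opprD addrACA.
Qed.

Lemma eq_ldiff c c' v : c =1 c' -> ldiff c v = ldiff c' v.
Proof. by move=> cc'; congr ldiff; apply/funext. Qed.

Lemma eq_lder x c c' v : c =1 c' -> lder x c v = lder x c' v.
Proof. by move=> cc'; congr lder; apply/funext. Qed.

Lemma lderD x c c' v :
  lder x (fun t => c t + c' t) v = lder x c v + lder x c' v.
Proof.
have := lder_lin x 1 c c' v; rewrite scale1r => <-.
by apply: eq_lder => t; rewrite scale1r.
Qed.

Lemma lderB x c c' v :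
  lder x (fun t => c t - c' t) v = lder x c v - lder x c' v.
Proof.
have := lder_lin x (-1) c' c v; rewrite scaleN1r addrC => <-.
by apply: eq_lder => t; rewrite scaleN1r addrC.
Qed.

Lemma lLieB x c c' v :
  lLie x (fun t => c t - c' t) v = lLie x c v - lLie x c' v.
Proof. by rewrite /lLie lderB lactDr lactNr; zmodule. Qed.

Lemma ldiffB c c' v :
  ldiff (fun t => c t - c' t) v = ldiff c v - ldiff c' v.
Proof.
have := ldiff_lin (-1) c' c v; rewrite scaleN1r addrC => <-.
by apply: eq_ldiff => t; rewrite scaleN1r addrC.
Qed.

Lemma ldiffD c c' v :
  ldiff (fun t => c t + c' t) v = ldiff c v + ldiff c' v.
Proof.
have := ldiff_lin 1 c c' v; rewrite scale1r => <-.
by apply: eq_ldiff => t; rewrite scale1r.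
Qed.

Lemma lder_lact x y c v : lder x (fun t => lact y (c t)) v = lact y (lder x c v).
Proof.
elim: v c => [|z v IHv] c /=; first by rewrite lact0r.
by rewrite IHv lactDr.
Qed.

Lemma lder_comm x y c v : slotlin c ->
  lder x (lder y c) v = lder y (lder x c) v - lder (lie x y) c v.
Proof.
elim: v c => [|z v IHv] c cl /=; first by rewrite subr0.
rewrite !lderD (IHv _ (slotlin_cons z cl)).
have jac : lie (lie x y) z = lie x (lie y z) - lie y (lie x z).
  have /eqP := lie_jacobi x y z.
  rewrite addr_eq0 (lie_antisym z (lie x y)) opprK => /eqP <-.
  by rewrite (lie_antisym z x) lieNr.
rewrite jac (slotlinD [::] v _ _ cl) (slotlinN [::] v _ cl) /=.
by zmodule.
Qed.

Lemma lLie_comm x y c v : slotlin c ->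
  lLie x (lLie y c) v = lLie y (lLie x c) v + lLie (lie x y) c v.
Proof.
move=> cl; rewrite /lLie !lderB !lder_lact lder_comm // !lactDr !lactNr lact_lie.
by zmodule.
Qed.

Lemma lLie_cons x c y v :
  lLie x c (y :: v) = lLie x (fun t => c (y :: t)) v - c (lie x y :: v).
Proof. by rewrite /lLie /=; zmodule. Qed.

(** Contraction with the first entry [y] reduces this to the commutation rule [lLie_comm], the
    bracket term coming from [lLie_cons]. *)
Lemma ldiff_lLie x c v : slotlin c -> ldiff (lLie x c) v = lLie x (ldiff c) v.
Proof.
elim: v c => [|y v IHv] c cl; first by rewrite /lLie /= lact0r subrr.
rewrite lLie_cons /= lLieB (lLie_comm x y) //.
under eq_ldiff => t do rewrite lLie_cons.
by rewrite ldiffB (IHv _ (slotlin_cons y cl)); zmodule.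
Qed.

(** Contracting d d c with [x] gives L_x d c - d L_x c + d d c', where c' is the contraction of [c];
    the first two terms cancel and induction removes the last. *)
Lemma ldiff_sq c v : slotlin c -> ldiff (ldiff c) v = 0.
Proof.
elim: v c => [|x v IHv] c cl //=.
by rewrite ldiffB (IHv _ (slotlin_cons x cl)) ldiff_lLie //; zmodule.
Qed.

Lemma slotlin_head c a x y : slotlin c ->
  (fun t => c ((a *: x + y) :: t)) = (fun t => a *: c (x :: t) + c (y :: t)).
Proof. by move=> cl; apply/funext => t; apply: (cl [::]). Qed.

Lemma lder_slotlin x c : slotlin c -> slotlin (lder x c).
Proof.
move=> cl u v a y z; elim: u c cl => [|b u IHu] c cl /=.
  rewrite (slotlin_head _ _ _ cl) lder_lin lie_linearr (cl [::]) /=.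
  by rewrite scalerDr addrACA.
by rewrite (IHu _ (slotlin_cons b cl)) (cl (_ :: u)) /= scalerDr addrACA.
Qed.

Lemma lder_linl v c a x y : slotlin c ->
  lder (a *: x + y) c v = a *: lder x c v + lder y c v.
Proof.
elim: v c => [|z v IHv] c cl /=; first by rewrite scaler0 addr0.
rewrite (IHv _ (slotlin_cons z cl)) lie_linearl (cl [::]) /=.
by rewrite scalerDr addrACA.
Qed.

Lemma lLie_linl v c a x y : slotlin c ->
  lLie (a *: x + y) c v = a *: lLie x c v + lLie y c v.
Proof.
by move=> cl; rewrite /lLie lder_linl // lact_linearl scalerBr opprD addrACA.
Qed.

Lemma lLie_slotlin x c : slotlin c -> slotlin (lLie x c).
Proof.
move=> cl; apply: (slotlinB (f := fun v => lact x (c v))).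
  exact: (slotlin_comp (q := lact x) (@lact_linearr _ _ _ x)).
exact: lder_slotlin.
Qed.

Lemma ldiff_slotlin c : slotlin c -> slotlin (ldiff c).
Proof.
move=> cl u v a y z; elim: u c cl => [|b u IHu] c cl /=.
  rewrite (slotlin_head _ _ _ cl) ldiff_lin lLie_linl //.
  by rewrite [in RHS]scalerBr opprD addrACA.
rewrite (IHu _ (slotlin_cons b cl)) (lLie_slotlin b cl).
by rewrite [in RHS]scalerBr opprD addrACA.
Qed.

Lemma lder0 x c v : (forall t, c t = 0) -> lder x c v = 0.
Proof. by elim: v c => //= y v IHv c c0; rewrite c0 IHv ?addr0. Qed.

Lemma ldiff0 c v : (forall t, c t = 0) -> ldiff c v = 0.
Proof.
elim: v c => //= y v IHv c c0.
by rewrite /lLie c0 lact0r lder0 // IHv // !subr0.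
Qed.

Lemma lder_lalt x c : slotlin c -> lalt c -> lalt (lder x c).
Proof.
move=> cl ca u y v; elim: u c cl ca => [|b u IHu] c cl ca /=.
  rewrite (lalt_antisym [::] _ _ _ cl ca) /= lder0 ?addr0 ?addNr //.
  exact: (ca [::]).
rewrite (IHu _ (slotlin_cons b cl) (lalt_cons b ca)) addr0.
exact: (ca (_ :: u)).
Qed.

Lemma lLie_lalt x c : slotlin c -> lalt c -> lalt (lLie x c).
Proof.
by move=> cl ca u y v; rewrite /lLie ca lact0r lder_lalt // subr0.
Qed.

Lemma ldiff_lalt c : slotlin c -> lalt c -> lalt (ldiff c).
Proof.
move=> cl ca u y v; elim: u c cl ca => [|b u IHu] c cl ca /=; last first.
  rewrite (IHu _ (slotlin_cons b cl) (lalt_cons b ca)) subr0.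
  exact: lLie_lalt.
rewrite lLie_cons liexx (slotlin0 [::] v cl) /= (ldiff0 (c := fun t => c _)).
  by zmodule.
exact: (ca [::]).
Qed.

End ListCochains.

Lemma codom_ordS (T : Type) n (x : 'I_n.+1 -> T) :
  codom x = x ord0 :: codom (x \o lift ord0).
Proof. by rewrite !codomE enum_ordSl /= -map_comp. Qed.

Lemma codom_ord0 (T : Type) (x : 'I_0 -> T) : codom x = [::].
Proof. by apply: size0nil; rewrite size_codom card_ord. Qed.

Lemma bump0n n : bump 0 n = n.+1.
Proof. by []. Qed.

Lemma bump_lt i k n : (k < n)%N -> (bump i k < n.+1)%N.
Proof. by rewrite /bump; case: (i <= k)%N => // kn; apply: ltnW. Qed.

Lemma comp_lift_lift (T : Type) n (x : 'I_n.+2 -> T) (i : 'I_n.+1) :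
  (x \o lift (lift ord0 i)) \o lift ord0 = (x \o lift ord0) \o lift i.
Proof.
apply/funext => k /=; congr x; apply: val_inj; rewrite /= /bump /=; lia.
Qed.

(** * Agreement with the alternating-sum differential *)

Section ExplicitDifferential.
Variables (K : fieldType) (g : lieAlgType K) (M : lieModType g).
Implicit Types (c : seq g -> M).

Lemma codom_lift_lift n (x : 'I_n.+2 -> g) i :
  codom (x \o lift (lift ord0 i)) = x ord0 :: codom ((x \o lift ord0) \o lift i).
Proof.
rewrite codom_ordS -comp_lift_lift; congr (_ :: _).
by rewrite /=; congr x; apply: val_inj.
Qed.

Lemma codom_lie_args0 n (x : 'I_n.+2 -> g) j :
  codom (lie_args x ord0 (lift ord0 j)) =
  lie (x ord0) (x (lift ord0 j)) :: codom ((x \o lift ord0) \o lift j).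
Proof.
rewrite codom_ordS; congr (_ :: _); congr codom; apply/funext => k /=.
rewrite /lie_args /=; congr x; apply: val_inj; rewrite /= !bump0n /= bumpS.
by rewrite inordK // ltnS (ltn_ord (lift j k)).
Qed.

Lemma codom_lie_argsS n (x : 'I_n.+3 -> g) (i j : 'I_n.+2) : (i < j)%N ->
  exists v, codom (lie_args (x \o lift ord0) i j) =
      lie (x (lift ord0 i)) (x (lift ord0 j)) :: v /\
    codom (lie_args x (lift ord0 i) (lift ord0 j)) =
      [:: lie (x (lift ord0 i)) (x (lift ord0 j)), x ord0 & v].
Proof.
move=> ij; exists (codom (lie_args (x \o lift ord0) i j \o lift ord0)).
split; first by rewrite codom_ordS.
rewrite codom_ordS; congr (_ :: _); rewrite codom_ordS; congr (_ :: _).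
  by rewrite /lie_args /=; congr x; apply: val_inj; rewrite /= inordK.
congr codom; apply/funext => k /=; rewrite /lie_args /=; congr x.
have kn : (bump j (bump i k) < n.+2)%N by do 2!apply: bump_lt; apply: ltn_ord.
apply: val_inj; rewrite /= !bump0n /=.
by rewrite !bumpS !inordK.
Qed.

(** The sign comes from moving [x, y_j] to the front past j entries. *)
Lemma lder_sum x c n (y : 'I_n.+1 -> g) : slotlin c -> lalt c ->
  lder x c (codom y) =
  \sum_(j < n.+1) (-1) ^+ j *: c (lie x (y j) :: codom (y \o lift j)).
Proof.
elim: n y c => [|n IHn] y c cl ca; rewrite codom_ordS /=.
  by rewrite codom_ord0 /= big_ord_recl big_ord0 expr0 scale1r codom_ord0.
rewrite big_ord_recl expr0 scale1r; congr (_ + _).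
rewrite (IHn _ _ (slotlin_cons _ cl) (lalt_cons _ ca)); apply: eq_bigr => j _.
rewrite lift0 codom_lift_lift (lalt_antisym [::]) //=.
by rewrite exprS mulN1r scaleNr scalerN.
Qed.

Definition ce_formula c n (x : 'I_n.+1 -> g) : M :=
  \sum_(i < n.+1) (-1) ^+ i *: lact (x i) (c (codom (x \o lift i))) +
  \sum_(i < n.+1) \sum_(j < n.+1 | (i < j)%N)
    (-1) ^+ (i + j) *: c (codom (lie_args x i j)).

(** Index 0 is split off: its terms form the Lie derivative along [x ord0], and the others are minus
    the formula for the contracted cochain in one argument fewer. *)
Lemma ce_formulaE c n (x : 'I_n.+1 -> g) : slotlin c -> lalt c ->
  ce_formula c x = ldiff c (codom x).
Proof.
elim: n x c => [|n IHn] x c cl ca; rewrite /ce_formula codom_ordS /=.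
  rewrite codom_ord0 !big_ord_recl !big_ord0 big1 => [|j].
    by rewrite expr0 scale1r codom_ord0 /lLie /= !subr0 !addr0.
  by rewrite [j]ord1.
rewrite -(IHn _ _ (slotlin_cons _ cl) (lalt_cons _ ca)) /lLie lder_sum //.
rewrite big_ord_recl [in X in _ + X]big_ord_recl expr0 scale1r /ce_formula.
have -> : \sum_(i < n.+1) (-1) ^+ lift ord0 i *: lact (x (lift ord0 i))
      (c (codom (x \o lift (lift ord0 i)))) =
    - \sum_(i < n.+1) (-1) ^+ i *: lact ((x \o lift ord0) i)
      (c (x ord0 :: codom ((x \o lift ord0) \o lift i))).
  rewrite -sumrN; apply: eq_bigr => i _.
  by rewrite codom_lift_lift lift0 exprS mulN1r scaleNr.
have -> : \sum_(j < n.+2 | (@ord0 n.+1 < j)%N) (-1) ^+ (@ord0 n.+1 + j) *: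
      c (codom (lie_args x ord0 j)) =
    - \sum_(j < n.+1) (-1) ^+ j *:
      c (lie (x ord0) ((x \o lift ord0) j) :: codom ((x \o lift ord0) \o lift j)).
  rewrite big_mkcond big_ord_recl /= add0r -sumrN; apply: eq_bigr => j _.
  by rewrite codom_lie_args0 /= bump0n add0n exprS mulN1r scaleNr.
have -> : \sum_(i < n.+1) \sum_(j < n.+2 | (lift ord0 i < j)%N)
      (-1) ^+ (lift ord0 i + j) *: c (codom (lie_args x (lift ord0 i) j)) =
    - \sum_(i < n.+1) \sum_(j < n.+1 | (i < j)%N)
      (-1) ^+ (i + j) *: c (x ord0 :: codom (lie_args (x \o lift ord0) i j)).
  rewrite -sumrN; apply: eq_bigr => i _.
  rewrite big_mkcond big_ord_recl /= add0r -sumrN [RHS]big_mkcond.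
  apply: eq_bigr => j _; rewrite /= !bump0n ltnS; case: ifP => // ij.
  case: n x i j ij {IHn} => [|n] x i j ij.
    by move: ij; rewrite [i]ord1 [j]ord1.
  have [v [-> ->]] := codom_lie_argsS x ij.
  rewrite (lalt_antisym [::]) //= addSn addnS !exprS mulrA mulN1r opprK mul1r.
  by rewrite scalerN.
by zmodule.
Qed.

Definition lcochain c n : ('I_n -> g) -> M := fun x => c (codom x).

Lemma codom_arg_upd n (x : 'I_n -> g) i : exists u v, forall z,
  codom (arg_upd x i z) = u ++ z :: v.
Proof.
elim: n x i => [|n IHn] x i; first by case: i.
case: (unliftP ord0 i) => [j|] ->.
  have [u [v uv]] := IHn (x \o lift ord0) j.
  exists (x ord0 :: u), v => z; rewrite codom_ordS /= -uv.
  have -> : arg_upd x (lift ord0 j) z ord0 = x ord0 by [].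
  congr (_ :: codom _); apply/funext => k; rewrite /arg_upd /= (inj_eq lift_inj).
exists [::], (codom (x \o lift ord0)) => z; rewrite codom_ordS /arg_upd eqxx.
by congr (_ :: codom _); apply/funext => k /=.
Qed.

Lemma cochainP n (z : cochain M n) : multilinear z /\ alternating z.
Proof. by case: z => z /= /cochain_predP. Qed.

Lemma lcochain_pred c n : slotlin c -> lalt c ->
  lcochain c (n := n) \in cochain_pred M n.
Proof.
move=> cl ca; apply/cochain_predP; split=> [x i a u v|x i j ij xij].
  by have [s [t st]] := codom_arg_upd x i; rewrite /lcochain !st cl.
apply: lalt_uniq => //; apply/negP => /injectiveP/(_ i j xij) E.
by rewrite E eqxx in ij.
Qed.

Lemma ce_diffE n (c : cochain M n) c' (x : 'I_n.+1 -> g) :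
  slotlin c' -> lalt c' -> (forall y, c y = c' (codom y)) ->
  ce_diff c x = ldiff c' (codom x).
Proof.
move=> cl ca cc'; rewrite -ce_formulaE // /ce_diff /ce_formula.
by congr (_ + _); apply: eq_bigr => i _; [|apply: eq_bigr => j _]; rewrite cc'.
Qed.

(* [z] as a list cochain, zero on lists of the wrong length. *)
Definition cochain_list n (z : cochain M n) (v : seq g) : M :=
  if size v == n then z (fun i => v`_i) else 0.

Lemma cochain_listE n (z : cochain M n) y : z y = cochain_list z (codom y).
Proof.
rewrite /cochain_list size_codom card_ord eqxx; congr (cochain_fun z _).
by apply/funext => i; rewrite (nth_map i) ?size_enum_ord // nth_ord_enum.
Qed.

Lemma cochain_list_slotlin n (z : cochain M n) : slotlin (cochain_list z).
Proof.
have [zl _] := cochainP z; move=> u v a x y.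
rewrite /cochain_list !size_cat /=; case: eqP => [szn|_]; last first.
  by rewrite scaler0 addr0.
have un : (size u < n)%N by rewrite -szn addnS ltnS leq_addr.
have upd t : (fun i : 'I_n => (u ++ t :: v)`_i) =
    arg_upd (fun i : 'I_n => (u ++ 0 :: v)`_i) (Ordinal un) t.
  apply/funext => i; rewrite /arg_upd -val_eqE /= !nth_cat.
  case: (ltngtP i (size u)) => [//|iu|->]; last by rewrite subnn.
  by rewrite -[(i - size u)%N]prednK ?subn_gt0.
by rewrite (upd (a *: x + y)) (upd x) (upd y) zl.
Qed.

Lemma cochain_list_lalt n (z : cochain M n) : lalt (cochain_list z).
Proof.
have [_ za] := cochainP z; move=> u x v.
rewrite /cochain_list size_cat /=; case: eqP => // szn.
have un : (size u < n)%N by rewrite -szn !addnS ltnS -addnS leq_addr.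
have uSn : ((size u).+1 < n)%N by rewrite -szn !addnS !ltnS leq_addr.
apply: (za _ (Ordinal un) (Ordinal uSn)) => /=.
  by rewrite -val_eqE /= neq_ltn ltnSn.
by rewrite !nth_cat ltnn subnn ltnNge leqnSn /= subSnn.
Qed.

Lemma ldiff_size c n v : (forall w, size w != n -> c w = 0) ->
  size v != n.+1 -> ldiff c v = 0.
Proof.
elim: v c n => //= x v IHv c n c0; rewrite eqSS => vn.
have l0 w : lder x c w = 0 \/ size w = n.
  have [->|wn] := eqVneq (size w) n; [by right|left].
  elim: w c n c0 wn {IHv vn} => //= y w IHw c [|n] c0 wn.
    by rewrite c0 // lder0 ?addr0 // => t; rewrite c0.
  by rewrite c0 // (IHw _ n) ?addr0 // => t tn; rewrite c0.
rewrite /lLie c0 // lact0r; case: (l0 v) => [->|/eqP]; last by rewrite (negPf vn).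
rewrite subr0; case: n c0 vn {l0} => [|n] c0 vn; last first.
  by rewrite (IHv _ n) ?subr0 // => w wn; rewrite c0.
by rewrite ldiff0 ?subr0 // => t; rewrite c0.
Qed.

Lemma cocycle_ldiff n (z : cocycle M n) v : ldiff (cochain_list z) v = 0.
Proof.
have [szv|nv] := eqVneq (size v) n.+1; last first.
  apply: (ldiff_size (n := n)) nv => w wn.
  by rewrite /cochain_list (negPf wn).
have zc : ce_diff z = 0 by apply/eqP; case: (z).
have <- : codom (fun i : 'I_n.+1 => v`_i) = v.
  apply: (@eq_from_nth _ 0) => [|i]; rewrite size_codom card_ord // => ilt.
  by rewrite (nth_map ord0) ?size_enum_ord // (nth_enum_ord _ ilt).
rewrite -(ce_diffE (c := z)) ?zc //.
- exact: cochain_list_slotlin.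
- exact: cochain_list_lalt.
- exact: cochain_listE.
Qed.

End ExplicitDifferential.

(** * Extending cocycles to the coinduced module *)

Section MlextAlternating.
Variables (K : fieldType) (V W : lmodType K) (S : {pred V}).

(** With [x] expanded in the basis, the diagonal terms vanish by the first hypothesis and the mixed
    ones cancel in pairs by the second. *)
Lemma mlext_lalt (F : seq V -> W) :
  (forall (u : seq V) (a : V) (v : seq V), F (u ++ a :: a :: v) = 0) ->
  (forall (u : seq V) (a b : V) (v : seq V),
    F (u ++ a :: b :: v) = - F (u ++ b :: a :: v)) ->
  lalt (mlext S F).
Proof.
move=> Faa Fab u x v; have fl := mlext_slotlin S F; set f := mlext S F in fl *.
have fl1 t := slotlin_catl t fl; have fl2 t := slotlin_catr t fl.
have zl : slotlin (fun _ : seq V => 0 : W).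
  by move=> *; rewrite scaler0 addr0.
apply: (slotlin_eq (S := S) (n := size u) (f := fun u => f (u ++ x :: x :: v))
  (g := fun=> 0)) => // {}u ub _.
have fl3 t : slotlin (fun v => f (u ++ t ++ v)).
  by move=> r s a y z; rewrite !(catA t) fl1.
apply: (slotlin_eq (S := S) (n := size v) (f := fun v => f (u ++ [:: x; x] ++ v))
  (g := fun=> 0)) => // {}v vb _ /=.
rewrite -[x](coords_sum S).
have: forall t, t \in coords S x -> basic S t.2 by move=> t /coordsP[].
have D y z t : f (u ++ (y + z) :: t) = f (u ++ y :: t) + f (u ++ z :: t).
  exact: slotlinD.
have D2 y z s : f (u ++ s :: (y + z) :: v) = f (u ++ s :: y :: v) + f (u ++ s :: z :: v).
  by rewrite -!(cat_rcons s) slotlinD.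
have Z a y t : f (u ++ (a *: y) :: t) = a *: f (u ++ y :: t).
  by rewrite -[a *: y]addr0 fl slotlin0 // addr0.
have Z2 a y s : f (u ++ s :: (a *: y) :: v) = a *: f (u ++ s :: y :: v).
  by rewrite -!(cat_rcons s) -[a *: y]addr0 fl slotlin0 // addr0.
have bas a b : basic S a -> basic S b ->
    f (u ++ a :: b :: v) = F (u ++ a :: b :: v).
  by move=> ab bb; rewrite /f mlext_basic // all_cat /= ub ab bb vb.
elim: (coords S x) => [|t l IHl] lb; first by rewrite big_nil slotlin0.
have tb : basic S t.2 by apply: lb; rewrite mem_head.
have {}lb s : s \in l -> basic S s.2 by move=> sl; apply: lb; rewrite inE sl orbT.
rewrite big_cons D !D2 (IHl lb) addr0 Z Z2 bas // Faa !scaler0 add0r.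
rewrite Z Z2 -scalerDr; move: (t.1) => k; suff -> : forall y : V, 
    (forall s, s \in l -> basic S s.2) -> y = \sum_(s <- l) s.1 *: s.2 ->
    f (u ++ t.2 :: y :: v) + f (u ++ y :: t.2 :: v) = 0 by rewrite ?scaler0.
move=> y _ ->; elim: l lb {IHl} => [|s l IHl] lb.
  by rewrite big_nil slotlin0 // -cat_rcons slotlin0 // addr0.
have sb : basic S s.2 by apply: lb; rewrite mem_head.
rewrite big_cons D D2 addrACA IHl ?addr0 => [|r rl]; last first.
  by apply: lb; rewrite inE rl orbT.
by rewrite Z Z2 -scalerDr !bas // Fab addNr scaler0.
Qed.

End MlextAlternating.

Section EvalAtWord.
Variables (K : fieldType) (p h : lieAlgType K) (iota : {lieMorphism p -> h}).
Variable N : lieModType p.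
Local Notation M := (coind iota N).
Implicit Types (c : seq h -> M) (I J w : seq h) (x y m : h).

Lemma slotlin_eval c w : slotlin c -> slotlin (fun J => c J w).
Proof. by move=> cl u v a x y; rewrite cl. Qed.

Lemma lalt_eval c w : lalt c -> lalt (fun J => c J w).
Proof. by move=> ca u x v; rewrite ca. Qed.

Lemma lder_consE c x y J w :
  lder x c (y :: J) w = c (lie x y :: J) w + lder x (fun t => c (y :: t)) J w.
Proof. by []. Qed.

Lemma lder_eval0 c x J w : (forall I, c I w = 0) -> lder x c J w = 0.
Proof. by elim: J c => // y J IHJ c c0; rewrite lder_consE c0 IHJ ?addr0. Qed.

Lemma ldiff_consE c x J w :
  ldiff c (x :: J) w =
  c J (rcons w x) - lder x c J w - ldiff (fun t => c (x :: t)) J w.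
Proof. by []. Qed.

(** Only two sources contribute at [w]: brackets, with values at [w] itself, and actions, with
    values at [w] lengthened by the removed entry. *)
Lemma ldiff_eval0 c J w : (forall I, c I w = 0) ->
  (forall u x v, J = u ++ x :: v -> c (u ++ v) (rcons w x) = 0) ->
  ldiff c J w = 0.
Proof.
elim: J c => // x J IHJ c c0 cJ.
rewrite ldiff_consE lder_eval0 // (cJ [::]) // IHJ ?subr0 // => u y v JE.
by apply: (cJ (x :: u)); rewrite JE.
Qed.

(** At the empty word, appending [iota x] is the same as prefixing it, that is, acting by [x]. *)
Lemma ldiff_iota c (z : seq p -> N) v :
  (forall t, c (map iota t) [::] = z t) ->
  ldiff c (map iota v) [::] = ldiff z v.
Proof.
have lder_iota (x : p) (t : seq p) (c' : seq h -> M) (z' : seq p -> N) :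
    (forall t, c' (map iota t) [::] = z' t) ->
    lder (iota x) c' (map iota t) [::] = lder x z' t.
  elim: t c' z' => // y t IHt c' z' cz; rewrite [map _ _]/= lder_consE -lie_morph /=.
  rewrite -(IHt (fun s => c' (iota y :: s)) (fun s => z' (y :: s))).
    by rewrite -(cz (_ :: t)).
  by move=> s; apply: (cz (_ :: s)).
elim: v c z => // x v IHv c z cz; rewrite [map _ _]/= ldiff_consE /=.
rewrite (IHv _ (fun s => z (x :: s))) => [|s]; last exact: (cz (_ :: s)).
by rewrite (lder_iota _ _ _ z) // coind_iota cz.
Qed.

End EvalAtWord.

(** * Extension of a cocycle, one word length at a time *)

Section ExtendCocycle.
Variables (K : fieldType) (p h : lieAlgType K) (iota : {lieMorphism p -> h}).
Hypothesis iota_inj : injective iota.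
Variables (N : lieModType p) (z : seq p -> N).
Hypotheses (zl : slotlin z) (za : lalt z) (zd : forall v, ldiff z v = 0).

Local Notation M := (coind iota N).
Local Notation S := (lie_im iota).
Local Notation retr := (retr iota).
Implicit Types (b : seq h -> M) (I J w : seq h) (x y m : h).

(** The starting point extends [z] along the linear retraction at the empty word; it is not a
    cocycle in general. *)
Definition ext0 I : M := coind_of iota_inj
  (fun w => if w is [::] then z (map retr I) else 0).

Lemma ext0_slotlin : slotlin ext0.
Proof.
move=> u v a x y; apply: coind_eq => w wn.
rewrite coindD coindZ !coind_of_normal //.
case: w {wn} => [|? ?]; last by rewrite scaler0 addr0.
by rewrite !map_cat /= retr_linear zl.
Qed.

Lemma ext0_lalt : lalt ext0.
Proof.
move=> u x v; apply: coind_eq => w wn; rewrite coind_of_normal //.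
by case: w {wn} => // ; rewrite map_cat /= za.
Qed.

Lemma ext0_iota v : ext0 (map iota v) [::] = z v.
Proof.
rewrite coind_of_normal // -map_comp; congr z.
by rewrite -[RHS]map_id; apply: eq_map; apply: (retrK iota_inj).
Qed.

(* The value at the word [rcons w m] forced by [ldiff (m :: I) w = 0] when [m]
   is larger than all letters of [I]. *)
Definition corr_top k b I w : N :=
  if (size w == k.+1) && all (fun x => adlt S x (last 0 w)) I
  then - ldiff b (last 0 w :: I) (take k w) else 0.

(** The order condition in [corr_top] is not linear in the entries, so its values are taken at basis
    vectors only and extended. *)
Definition corr k b : seq h -> M :=
  mlext S (fun I => coind_of iota_inj (corr_top k b I)).

Lemma corr_slotlin k b : slotlin (corr k b).
Proof. exact: mlext_slotlin. Qed.

Lemma corr_lalt k b : slotlin b -> lalt b -> lalt (corr k b).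
Proof.
move=> bl ba; have dl := ldiff_slotlin bl; have da := ldiff_lalt bl ba.
apply: mlext_lalt => [u a v|u a c v]; apply: coind_eq => w wn.
  rewrite coind_of_normal // /corr_top; case: ifP => // _.
  by rewrite (da (_ :: u)) coind0 oppr0.
have topN : corr_top k b (u ++ a :: c :: v) w = - corr_top k b (u ++ c :: a :: v) w.
  rewrite /corr_top; move: (ldiff b) dl da => d dl da.
  rewrite !all_cat /= (andbCA (adlt S c _)).
  case: ifP => // _; last by rewrite oppr0.
  by have /= -> := lalt_antisym (last 0 w :: u) a c v dl da; rewrite coindN.
by move: (corr_top k b) topN => F FE; rewrite coindN !coind_of_normal.
Qed.

Lemma corr_low k b J w : (size w <= k)%N -> corr k b J w = 0.
Proof.
move=> wk; apply: (slotlin_eq (S := S) (n := size J)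
  (f := fun J => corr k b J w) (g := fun=> 0)) => //.
- exact/slotlin_eval/corr_slotlin.
- by move=> *; rewrite scaler0 addr0.
move=> I Ib _; rewrite /corr mlext_basic //.
apply: (coind_vanish (k := k)) wk => v vn vk.
by rewrite coind_of_normal // /corr_top eqn_leq [(k < _)%N]ltnNge vk andbF.
Qed.

Lemma corr_normal k b J w : all (basic S) J -> normal_word iota w ->
  corr k b J w = corr_top k b J w.
Proof. by move=> Jb wn; rewrite /corr mlext_basic // coind_of_normal. Qed.

(** The strict inequality in [corr_top] excludes an entry [m] of [J] that dominates [w]. Vanishing
    on words of length at most [k] allows [w] to be unsorted. *)
Lemma corr_dominated k b J w m : all (basic S) J -> all (basic S) w ->
  size w = k.+1 -> m \in J -> all (fun x => adle S x m) w -> corr k b J w = 0.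
Proof.
move=> Jb wb szw mJ wm.
have low t : (size t < size w)%N -> corr k b J t = 0.
  by rewrite szw ltnS; apply: corr_low.
have pw : perm_eq w (lsort S w) by rewrite perm_sym perm_lsort.
have [/allP nS|/allPn[x xw]] := boolP (all [predC S] w); last first.
  by rewrite negbK => xS; apply: coind_lead_im xS xw.
rewrite (coind_perm low pw) corr_normal //; last first.
  by rewrite /normal_word -!(perm_all _ pw) wb lsort_sorted; apply/allP.
rewrite /corr_top; case: ifP => // /andP[_ /allP/(_ m mJ)].
rewrite adltNle (allP wm) // (perm_mem pw).
have := size_lsort S w; rewrite szw.
by case: (lsort S w) => [//|a s _]; exact: (mem_last a s).
Qed.

Section Step.
Variables (k : nat) (b : seq h -> M).
Hypotheses (bl : slotlin b) (ba : lalt b).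
Hypothesis b_iota : forall v, b (map iota v) [::] = z v.
Hypothesis b_low : forall J w, (size w < k)%N -> ldiff b J w = 0.

Definition step I : M := b I + corr k b I.

Lemma step_slotlin : slotlin step.
Proof. exact: slotlin_add bl (@corr_slotlin k b). Qed.

Lemma step_lalt : lalt step.
Proof. by move=> u x v; rewrite /step ba corr_lalt // addr0. Qed.

Lemma step_iota v : step (map iota v) [::] = z v.
Proof. by rewrite /step coindD corr_low // addr0 b_iota. Qed.

Lemma ldiff_stepE J w : ldiff step J w = ldiff b J w + ldiff (corr k b) J w.
Proof. by rewrite -coindD -ldiffD. Qed.

Lemma step_low J w : (size w < k)%N -> ldiff step J w = 0.
Proof.
move=> wk; rewrite ldiff_stepE b_low // add0r; apply: ldiff_eval0 => [I|u x v _].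
  by apply: corr_low; apply: ltnW.
by apply: corr_low; rewrite size_rcons.
Qed.

(** With [m] moved to the front of [J] and [w] sorted, the action term of [m] in the differential of
    the correction is [- ldiff b (m :: I) w] by construction, and every other term of that
    differential vanishes. *)
Lemma step_dominated J w m : all (basic S) J -> all (basic S) w ->
  size w = k -> m \in J -> m \notin S -> all (fun x => adle S x m) (J ++ w) ->
  ldiff step J w = 0.
Proof.
move=> Jb wb szw mJ mS; rewrite all_cat => /andP[].
have dl := slotlin_eval w (ldiff_slotlin step_slotlin).
have da := lalt_eval w (ldiff_lalt step_slotlin step_lalt).
case/splitPr: mJ Jb => u v; rewrite all_cat /= => /and3P[ub mb vb].
rewrite all_cat /= => /and3P[um _ vm] wm.
apply: (lalt_move (c := fun J => ldiff step J w)) => //.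
set I := u ++ v; have Ib : all (basic S) I by rewrite all_cat ub.
have Im : all (fun x => adle S x m) I by rewrite all_cat um.
have [mI|mI] := boolP (m \in I).
  exact: (lalt_dup (c := fun J => ldiff step J w)).
have {Im}Im : all (fun x => adlt S x m) I.
  apply/allP => x xI; rewrite /adlt (allP Im) //=.
  by apply: contraNneq mI => <-.
have low t : (size t < size w)%N -> ldiff step (m :: I) t = 0.
  by rewrite szw; apply: step_low.
have pw : perm_eq w (lsort S w) by rewrite perm_sym perm_lsort.
have [/allP nS|/allPn[x xw]] := boolP (all [predC S] w); last first.
  by rewrite negbK => xS; apply: coind_lead_im xS xw.
rewrite (coind_perm low pw); move: wb wm szw nS; rewrite !(perm_all _ pw).
rewrite -(size_lsort S w); have := lsort_sorted S w.
move: (lsort S w) (perm_mem pw) => w' ww' ws wb wm szw nS {dl da low pw}.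
(* [m] is largest and outside [S], so appending it keeps the sorted word normal. *)
have nw : normal_word iota (rcons w' m).
  rewrite /normal_word !all_rcons wb mb /= mS.
  rewrite (sorted_pairwise (@adle_trans _ _ S)) pairwise_rcons wm.
  rewrite -(sorted_pairwise (@adle_trans _ _ S)) ws /=.
  by apply/allP => x xw'; apply: nS; rewrite ww'.
rewrite ldiff_stepE [in X in _ + X]ldiff_consE corr_normal //.
rewrite /corr_top size_rcons szw eqxx last_rcons Im /=.
rewrite -cats1 take_size_cat // lder_eval0 => [|t]; last first.
  by apply: corr_low; rewrite szw.
rewrite ldiff_eval0 ?subr0 ?addrN // => [t|s x t IE].
  by apply: corr_low; rewrite szw.
(* The entry [m] stays behind when [x] is removed, and it dominates the word lengthened by [x]. *)
have [xb xm] : basic S x /\ adle S x m.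
  have xI : x \in I by rewrite IE mem_cat mem_head orbT.
  by rewrite (allP Ib) //; have /andP[] := allP Im x xI.
apply: (corr_dominated _ (m := m)); rewrite ?size_rcons ?szw ?mem_head //.
- by move: Ib; rewrite IE /= !all_cat mb /= => /and3P[-> _ ->].
- by rewrite all_rcons xb.
- by rewrite all_rcons xm.
Qed.

Lemma step_diff J w : (size w < k.+1)%N -> ldiff step J w = 0.
Proof.
rewrite ltnS leq_eqVlt => /orP[/eqP szw|]; last exact: step_low.
have dl := ldiff_slotlin step_slotlin.
have zsl (V : lmodType K) : slotlin (fun _ : seq V => 0 : N).
  by move=> *; rewrite scaler0 addr0.
apply: (slotlin_eq (S := S) (n := size J)
  (f := fun J => ldiff step J w) (g := fun=> 0)) => //.
  exact: slotlin_eval.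
move=> {}J Jb _; move: w szw.
apply: (slotlin_eq (S := S) (n := k)
  (f := ldiff step J) (g := fun=> 0)) => // [|w wb szw].
  exact: coind_slotlin.
have low t : (size t < size w)%N -> ldiff step J t = 0.
  by rewrite szw; apply: step_low.
have pw : perm_eq w (lsort S w) by rewrite perm_sym perm_lsort.
have [/allP nS|/allPn[x xw]] := boolP (all [predC S] w); last first.
  by rewrite negbK => xS; apply: coind_lead_im xS xw.
rewrite (coind_perm low pw); move: wb szw nS; rewrite !(perm_all _ pw).
rewrite -(size_lsort S w); have := lsort_sorted S w.
move: (lsort S w) (perm_mem pw) => w' ww' ws wb szw nS {low pw dl}.
have {}nS x : x \in w' -> x \notin S by rewrite -ww'; apply: nS.
case: J Jb => // j J Jb; have [m mJ mmax] := max_mem S id j J.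
set I := j :: J in Jb mJ mmax *; clearbody I => {j J}.
case: (lastP w') => [|v x] in ws wb szw nS {w ww'} *.
  have [mS|mS] := boolP (m \in S); last first.
    apply: (step_dominated (m := m)); rewrite ?cats0 //.
    exact/allP/mmax.
  (* All entries now lie in [S] and the word is empty, so the claim is the cocycle condition on
     [z]. *)
  have -> : I = map iota (map retr I).
    rewrite -map_comp -[LHS]map_id; apply/eq_in_map => y yI.
    by rewrite /= iota_retr //; apply: adle_sub (mmax y yI) mS.
  by rewrite (ldiff_iota _ step_iota).
have vx : all (fun y => adle S y x) v.
  move: ws; rewrite (sorted_pairwise (@adle_trans _ _ S)) pairwise_rcons.
  by case/andP.
have xS : x \notin S by apply: nS; rewrite mem_rcons mem_head.
have [xm|mx] := boolP (adle S x m).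
  apply: (step_dominated (m := m)) => //.
    by apply: contraNN xS => mS; apply: adle_sub xm mS.
  rewrite all_cat all_rcons xm /=; apply/andP; split; first exact/allP/mmax.
  by apply/allP => y /(allP vx) yx; apply: adle_trans yx xm.
rewrite -adltNle in mx.
(* The largest letter [x] is in the word. The identity d d = 0 at [x :: I] and [v] isolates the
   wanted value: bracket terms sit at the shorter word [v], and in the other action terms [x] is a
   dominating entry. *)
have := congr1 (fun f : M => f v) (ldiff_sq (x :: I) step_slotlin).
rewrite ldiff_consE coind0.
move: wb szw; rewrite all_rcons size_rcons => /andP[xb vb] szv.
have vk : (size v < k)%N by rewrite -szv.
rewrite lder_eval0 => [|t]; last exact: step_low.
rewrite (ldiff_eval0 (c := fun t => ldiff step (x :: t))) => [|t|s y t IE].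
- by rewrite !subr0.
- exact: step_low.
have yI : y \in I by rewrite IE mem_cat mem_head orbT.
have Ix c : c \in I -> adle S c x.
  by move=> cI; apply: adle_trans (mmax c cI) _; case/andP: mx.
have sub : {subset s ++ t <= I}.
  by move=> c; rewrite IE !mem_cat inE => /orP[->//|->]; rewrite !orbT.
apply: (step_dominated (m := x)); rewrite ?size_rcons ?mem_head //=.
- by rewrite xb; apply/allP => c /sub; apply: (allP Jb).
- by rewrite all_rcons vb (allP Jb).
- rewrite adle_xx all_cat all_rcons Ix // vx !andbT.
  by apply/allP => c /sub; apply: Ix.
Qed.

End Step.

Fixpoint stage k : seq h -> M :=
  if k is k'.+1 then step k' (stage k') else ext0.

Lemma stageP k : [/\ slotlin (stage k), lalt (stage k),
  forall v, stage k (map iota v) [::] = z v &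
  forall J w, (size w < k)%N -> ldiff (stage k) J w = 0].
Proof.
elim: k => [|k [sl sa si sd]] /=.
  by split=> //; [exact: ext0_slotlin|exact: ext0_lalt|exact: ext0_iota].
split; [exact: step_slotlin|exact: step_lalt|exact: step_iota|].
by move=> J w; apply: step_diff.
Qed.

(** Step [k] changes nothing on words of length at most [k], so the value at [w] is final from stage
    [size w] on. *)
Lemma stage_stable k I w : (size w <= k)%N ->
  stage (size w) I w = stage k I w.
Proof.
elim: k => [|k IHk]; first by rewrite leqn0 => /eqP ->.
rewrite leq_eqVlt => /orP[/eqP -> //|wk].
by rewrite -[stage k.+1 I]/(step k (stage k) I) coindD corr_low // addr0 IHk.
Qed.

Lemma limit_coind I : (fun w => stage (size w) I w) \in coind_pred iota (N := N).
Proof.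
apply/asboolP; split=> [u v a x y|k u x y v _|k x w _].
- by rewrite !size_cat coind_slotlin.
(* The word with the bracket is one letter shorter, so its stage is raised to the common one. *)
- rewrite (@stage_stable (size (u ++ [:: x, y & v])) I (u ++ lie x y :: v)).
    rewrite !size_cat /=.
    exact: (coind_lie (stage _ I) (k := size u + size v + 2)).
  by rewrite !size_cat /= leq_add2l.
- by rewrite coind_iota (@stage_stable (size (iota x :: w)) I w) /=.
Qed.

Definition limit I : M := Coind (limit_coind I).

Lemma limitE I w k : (size w <= k)%N -> limit I w = stage k I w.
Proof. exact: stage_stable. Qed.

Lemma limit_slotlin : slotlin limit.
Proof.
move=> u v a x y; apply: val_inj; apply/funext => w.
by have [sl _ _ _] := stageP (size w); apply: (slotlin_eval w sl).
Qed.

Lemma limit_lalt : lalt limit.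
Proof.
move=> u x v; apply: val_inj; apply/funext => w.
by have [_ sa _ _] := stageP (size w); apply: (lalt_eval w sa).
Qed.

Lemma limit_iota v : limit (map iota v) [::] = z v.
Proof. exact: ext0_iota. Qed.

Lemma limit_diff J : ldiff limit J = 0.
Proof.
apply: val_inj; apply/funext => w; rewrite -[RHS]/(0 : N).
(* The differential at [w] only uses words of length at most [k], where [limit] agrees with stage
   [k]. *)
set k := (size w).+1; have [_ _ _ sd] := stageP k.
have := @ldiff_eval0 _ _ _ _ _ (fun t => limit t - stage k t) J w.
rewrite ldiffB coindD coindN sd // subr0; apply=> [I|u x v _].
  by rewrite coindD coindN (limitE _ (leqnSn _)) subrr.
by rewrite coindD coindN (@limitE _ _ k) ?size_rcons // subrr.
Qed.

End ExtendCocycle.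

(** * Comparison of the dimensions *)

Lemma coh_class_neq0 (K : fieldType) (g : lieAlgType K) (M : lieModType g) n
    (z : cocycle M n) : coh_class z != 0 <-> ~ is_coboundary z.
Proof.
have <- : coh_class (0 : cocycle M n) = 0 by rewrite /coh_class raddf0.
rewrite /coh_class -Quotient.idealrBE subr0.
by split=> [/negP nz cz|nz]; [apply/nz/asboolP|apply/negP => /asboolP].
Qed.

Section Pushforward.
Variables (K : fieldType) (g : lieAlgType K) (M1 M2 : lieModType g).
Variable f : {linear M1 -> M2}.
Hypothesis f_act : forall x m, f (lact x m) = lact x (f m).

Lemma push_cochain n (c : cochain M1 n) :
  (fun x => f (c x)) \in cochain_pred M2 n.
Proof.
have [cl ca] := cochainP c; apply/cochain_predP.
split=> [x i a u v|x i j ij xij]; first by rewrite cl linearP.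
by rewrite (ca _ _ _ ij) // linear0.
Qed.

(** Composition with an equivariant linear map commutes with [ce_diff]. *)
Lemma push_coboundary n (c1 : cochain M1 n) (c2 : cochain M2 n) :
  (forall x, c2 x = f (c1 x)) -> is_coboundary c1 -> is_coboundary c2.
Proof.
case: n c1 c2 => [|n] c1 c2 c12 /=.
  by move=> c0; apply: val_inj; apply/funext => x /=; rewrite c12 c0 linear0.
case=> b bc; exists (Cochain (push_cochain b)); apply/funext => x.
rewrite c12 -bc /ce_diff linearD !linear_sum.
congr (_ + _); apply: eq_bigr => i _; first by rewrite linearZ f_act.
by rewrite linear_sum; apply: eq_bigr => j _; rewrite linearZ.
Qed.

End Pushforward.

Section Image.
Variables (K : fieldType) (g h : lieAlgType K) (phi : {lieMorphism g -> h}).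

Definition im_incl (y : lie_image phi) : h := val y.

Fact im_incl_linear : linear im_incl.
Proof. by []. Qed.

Fact im_incl_lie : {morph im_incl : x y / lie x y}.
Proof. by []. Qed.

HB.instance Definition _ :=
  GRing.isLinear.Build K (lie_image phi) h *:%R im_incl im_incl_linear.
HB.instance Definition _ :=
  isLieMorphism.Build K (lie_image phi) h im_incl im_incl_lie.

Lemma im_incl_inj : injective im_incl.
Proof. exact: val_inj. Qed.

Local Notation phi' := (lie_corestr phi : {lieMorphism g -> lie_image phi}).
Local Notation iota := (im_incl : {lieMorphism lie_image phi -> h}).

(** Restriction along [phi] and restriction in two steps have the same carrier and action but are
    different module instances; the identity compares them. *)
Definition res_res (M : lieModType h) :
  lie_res phi' (lie_res iota M) -> lie_res phi M := id.

Fact res_res_linear M : linear (@res_res M).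
Proof. by []. Qed.

HB.instance Definition _ M := GRing.isLinear.Build K
  (lie_res phi' (lie_res iota M)) (lie_res phi M) *:%R (@res_res M)
  (@res_res_linear M).

(** The map induced by [phi] is that of [iota] followed by that of [phi'], so a class killed by the
    composite is not the given one. *)
Lemma coh_map_incl (M : lieModType h) n (z : cocycle M n) :
  coh_map phi (coh_class z) != 0 ->
  coh_map phi' (coh_class (pullback_cocyc iota z)) != 0.
Proof.
rewrite !coh_map_class => /coh_class_neq0 nz; apply/coh_class_neq0 => zb.
by apply: nz; apply: (push_coboundary (f := @res_res M)) zb.
Qed.

Section Extension.
Variable N : lieModType (lie_image phi).

Definition coind_ev : lie_res phi (coind iota N) -> lie_res phi' N :=
  fun f => (f : coind iota N) [::].

Fact coind_ev_linear : linear coind_ev.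
Proof. by []. Qed.

HB.instance Definition _ := GRing.isLinear.Build K
  (lie_res phi (coind iota N)) (lie_res phi' N) *:%R coind_ev coind_ev_linear.

Lemma coind_ev_act x f : coind_ev (lact x f) = lact x (coind_ev f).
Proof. exact: (coind_iota (f : coind iota N) (phi' x) [::]). Qed.

Lemma cocycle_extends n (z : cocycle N n) :
  exists b : cocycle (coind iota N) n,
    forall x, b (iota \o x) [::] = z x.
Proof.
pose zl := cochain_list_slotlin z; pose za := cochain_list_lalt z.
pose zd := cocycle_ldiff z.
have bl := limit_slotlin im_incl_inj zl za zd.
have ba := limit_lalt im_incl_inj zl za zd.
pose b := Cochain (lcochain_pred n bl ba).
have bP : b \in cocycle_pred (coind iota N) n.
  apply/eqP; apply/funext => x.
  by rewrite (ce_diffE x bl ba) ?limit_diff.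
exists (Cocycle bP) => x; rewrite [RHS]cochain_listE.
rewrite -(limit_iota im_incl_inj (cochain_list z)).
by rewrite /= /lcochain !codomE map_comp.
Qed.

Lemma coh_map_coind n (z : cocycle N n) :
  coh_map phi' (coh_class z) != 0 ->
  exists a : cohomology (coind iota N) n, coh_map phi a != 0.
Proof.
have [b bz] := cocycle_extends z; rewrite coh_map_class => /coh_class_neq0 nz.
exists (coh_class b); rewrite coh_map_class; apply/coh_class_neq0 => bb.
(* Evaluation at the empty word would carry a coboundary for the pullback of [b] to one for that of
   [z]. *)
apply: nz; apply: (push_coboundary (f := coind_ev)) bb => [x f|x].
  exact: coind_ev_act.
exact: (esym (bz (phi' \o x))).
Qed.

End Extension.

End Image.

Theorem theorem4p1 (K : fieldType) (g h : lieAlgType K)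
    (phi : {lieMorphism g -> h}) :
  lie_cd phi = lie_cd (lie_corestr phi).
Proof.
(* Even the sets of degrees with a nonzero induced map coincide. *)
congr nat_sup; apply/funext => n; apply/propext; split=> -[M [a]].
  rewrite -[a]reprK => /coh_map_incl nz.
  by exists (lie_res (@im_incl _ _ _ phi) M); eexists; exact: nz.
by rewrite -[a]reprK => /coh_map_coind nz; exists (coind (@im_incl _ _ _ phi) M).
Qed.
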